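(* Let $A\in\mathbb R^{n\times n}$ be symmetric positive definite, $\Lambda=\operatorname{diag}(A)$, and $\bar A=\sqrt{\Lambda}^{-1}A\sqrt{\Lambda}^{-1}$. Let $\tau\ge 1$ be an integer, $\beta\in(0,2)$, and let $(x^{(j)})_{j\ge0}$ be generated by the asynchronous Jacobi/RGS iteration described in the context (in either the shared memory or the distributed memory model) with delay bound $\tau$, where the update directions $d^{(0)},d^{(1)},\dotsc$ are i.i.d. uniform on $\{I_1,\dotsc,I_n\}$ and independent of the baseline communication schedule $\mathcal S=\{\tilde\Phi(j)\}_{j\ge0}$. Let $$\rho:=\frac1n\max_{t=1,\dotsc,n}\sum_{r=1}^n\bigl|(\bar A_{\rm off})_{r,t}\bigr|,\qquad \omega_\tau:=\sqrt{\rho\tau}+\rho\tau ,$$ and assume that $$2-\beta-2\beta\omega_\tau>0 .$$ Let $x^\star$ be the solution of $Ax^\star=b$ and $\mathbb E_j:=\mathbb E\bigl[\|x^{(j)}-x^\star\|_A^2\bigr]$. Then, for every integer $l_0\ge1$ and every integer $t\ge0$, $$\mathbb E_{t(\tau+l_0)}\le\left(1-\frac{a_\tau c_{l_0,\tau}}{1+\beta\bigl(2-\beta-\beta\omega_\tau+\beta\tau\bigr)c_{l_0,\tau}+2\beta\sqrt{\tau c_{l_0,\tau}}}\right)^t\mathbb E_0,$$ where $$a_\tau:=\beta\bigl(2-\beta-2\beta\omega_\tau\bigr)>0$$ and, with $\mu:=\lambda_{\min}(\bar A)/n$, $$c_{l_0,\tau}:=\frac{\mu l_0}{\bigl[1+\beta\sqrt{\mu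 l_0(\tau+l_0-1)}+\beta\omega_\tau\bigr]^2}.$$
   Context: Notation. $I_1,\dotsc,I_n$ are the columns of the $n\times n$ identity matrix; for an index set $\Omega$, $I_\Omega$ is the matrix whose columns are $I_k$, $k\in\Omega$. $\|v\|_A=\sqrt{v^\top Av}$. $\lambda_{\min}$ denotes the smallest eigenvalue. Asynchronous Jacobi/RGS iteration (unified model). Let $A\in\mathbb R^{n\times n}$ be symmetric positive definite, $b\in\mathbb R^n$, $x^\star=A^{-1}b$, $\Lambda=\operatorname{diag}(A)$ the diagonal part of $A$, $\beta$ a relaxation parameter, and $x^{(0)}\in\mathbb R^n$ a fixed initial guess. For $j=0,1,2,\dotsc$ a random direction $d^{(j)}\in\{I_1,\dotsc,I_n\}$ is drawn, and with a read set $\Phi_j\subseteq\{0,\dotsc,j-1\}$ (specified below; it may depend on $d^{(j)}$) one sets $$x^{(\Phi_j)}=x^{(0)}+\sum_{k\in\Phi_j}\frac{\beta d^{(k)}\gamma^{(k)}}{(d^{(k)})^\top\Lambda d^{(k)}},\qquad \gamma^{(j)}=(d^{(j)})^\top A\bigl(x^\star-x^{(\Phi_j)}\bigr),\qquad x^{(j+1)}=x^{(j)}+\frac{\beta d^{(j)}\gamma^{(j)}}{(d^{(j)})^\top\Lambda d^{(j)}}.$$ Baseline communication schedule. $\mathcal S=\{\tilde\Phi(j)\}_{j\ge0}$ is a (possibly random) sequence of sets, every realization of which satisfies the bounded-delay condition with the constant $\tau$ (which does not depend on the directions): $\{k:0\le k\le j-\tau\}\subseteq\tilde\Phi(j)\subseteq\{0,\dotsc,j-1\}$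 for all $j\ge0$. Shared memory model: $\Phi_j=\tilde\Phi(j)$, and $\bar A_{\rm off}:=\bar A$. Distributed memory model: a partition $\{\Omega_i\}_{i=1}^p$ of $\{1,\dotsc,n\}$ among $p$ nodes is fixed. If $d^{(j)}=I_k$ with $k\in\Omega_i$, then $\Phi_j=\tilde\Phi(j)\cup\Psi_j$, where $\Psi_j=\{k'<j: d^{(k')}\in\{I_m:m\in\Omega_i\}\}$ is the set of all earlier iterations that updated a component in $\Omega_i$ (so all components of $x^{(j)}$ in $\Omega_i$ are read with their current values). In this model $\bar A_{\rm off}$ is the block off-diagonal part of $\bar A$: $(I_{\Omega_r})^\top\bar A_{\rm off}I_{\Omega_t}=(I_{\Omega_r})^\top\bar AI_{\Omega_t}$ for $r\ne t$, and $(I_{\Omega_r})^\top\bar A_{\rm off}I_{\Omega_t}=0$ for $r=t$. *)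

(* Defs.v *)
From HB Require Import structures.
From mathcomp Require Import all_boot all_order all_algebra.
From mathcomp Require Import all_classical all_reals all_analysis.

Set Implicit Arguments.
Unset Strict Implicit.
Unset Printing Implicit Defensive.

Import Order.TTheory GRing.Theory Num.Theory.
Import numFieldNormedType.Exports.

Local Open Scope classical_set_scope.
Local Open Scope ring_scope.

Section LinearAlgebra.
Variables (R : realType) (n : nat).
Implicit Types (A M : 'M[R]_n) (v : 'cV[R]_n).

Definition sym_posdef A : Prop :=
  A^T = A /\ forall v, v != 0 -> 0 < (v^T *m A *m v) 0 0.

Definition energy_norm A v : R := Num.sqrt ((v^T *m A *m v) 0 0).

Definition diag_part A : 'M[R]_n := diag_mx (\row_i A i i).

(* The entrywise square root is the matrix square root here, because
   [diag_part A] is diagonal and [Num.sqrt 0 = 0]. *)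
Definition rescaled A : 'M[R]_n :=
  let S := map_mx Num.sqrt (diag_part A) in invmx S *m A *m invmx S.

(* The spectrum is finite, so for symmetric [M] with [0 < n] this infimum is
   attained: it is the smallest eigenvalue. *)
Definition lambda_min M : R := inf [set l : R | eigenvalue M l].

Definition unit_dir (i : 'I_n) : 'cV[R]_n := delta_mx i 0.

End LinearAlgebra.

(* Shared memory, or distributed memory whose nodes own the blocks of a
   partition of the coordinates. *)
Variant memory_model (n : nat) : Type :=
| Shared
| Distributed (Q : {set {set 'I_n}}) of finset.partition Q [set: 'I_n]%SET.

Section Iteration.
Variables (R : realType) (n : nat).

Definition off_part (m : memory_model n) (M : 'M[R]_n) : 'M[R]_n :=
  match m with
  | Shared => M
  | Distributed Q _ =>
      \matrix_(r, t) (if t \in finset.pblock Q r then 0 else M r t)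
  end.

(* A read set at step [j] is a subset of {0, ..., j-1}, i.e. a [{set 'I_j}].
   [dir k] is the index of the coordinate updated at step [k]. *)
Definition read_set (m : memory_model n) (dir : nat -> 'I_n)
    (Phit : forall j : nat, {set 'I_j}) (j : nat) : {set 'I_j} :=
  match m with
  | Shared => Phit j
  | Distributed Q _ =>
      (Phit j :|: [set k : 'I_j | dir k \in finset.pblock Q (dir j)])%SET
  end.

(* Stated without subtraction since [j - tau] would be truncated at 0. *)
Definition bounded_delay (tau : nat) (Phit : forall j : nat, {set 'I_j}) : Prop :=
  forall (j : nat) (k : 'I_j), (k + tau <= j)%N -> k \in Phit j.

Definition update (A : 'M[R]_n) (beta : R) (dir : nat -> 'I_n)
    (gamma : nat -> R) (k : nat) : 'cV[R]_n :=
  let d := unit_dir R (dir k) in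
  (beta * gamma k / (d^T *m diag_part A *m d) 0 0) *: d.

Definition async_iteration (A : 'M[R]_n) (xstar x0 : 'cV[R]_n) (beta : R)
    (dir : nat -> 'I_n) (Phi : forall j : nat, {set 'I_j})
    (gamma : nat -> R) (x : nat -> 'cV[R]_n) : Prop :=
  x 0%N = x0 /\
  forall j : nat,
    let xread := x0 + \sum_(k in Phi j) update A beta dir gamma k in
    gamma j = ((unit_dir R (dir j))^T *m A *m (xstar - xread)) 0 0 /\
    x j.+1 = x j + update A beta dir gamma j.

End Iteration.

Section Independence.
Context (dT : measure_display) (T : measurableType dT) (R : realType).
Variable P : probability T R.

(* Random variables with values in finite types: every set of values is
   measurable. *)
Definition finite_rv (V : finType) (X : T -> V) : Prop :=
  forall v : V, measurable (X @^-1` [set v]).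

Definition sigma_gen (I : Type) (V : I -> finType) (X : forall i, T -> V i) :
    set (set T) :=
  <<s [set E | exists (i : I) (B : set (V i)), E = X i @^-1` B] >>.

Definition mutually_independent (V : finType) (X : nat -> T -> V) : Prop :=
  forall (s : seq nat) (B : nat -> set V), uniq s ->
    P (\bigcap_(j in [set` s]) (X j @^-1` B j)) =
    (\prod_(j <- s) P (X j @^-1` B j))%E.

Definition independent_sequences (I J : Type) (V : I -> finType)
    (W : J -> finType) (X : forall i, T -> V i) (Y : forall j, T -> W j) : Prop :=
  forall E F : set T, sigma_gen X E -> sigma_gen Y F ->
    P (E `&` F) = (P E * P F)%E.

Definition iid_uniform (n : nat) (X : nat -> T -> 'I_n) : Prop :=
  (forall (j : nat) (i : 'I_n), P (X j @^-1` [set i]) = (n%:R^-1)%:E) /\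
  mutually_independent X.

End Independence.

Section Constants.
Variables (R : realType) (n : nat).

Definition rho (m : memory_model n) (A : 'M[R]_n) : R :=
  n%:R^-1 * \big[Num.max/0]_(t < n) \sum_(r < n) `|off_part m (rescaled A) r t|.

Definition omega (rh : R) (tau : nat) : R :=
  Num.sqrt (rh * tau%:R) + rh * tau%:R.

Definition a_const (beta om : R) : R := beta * (2 - beta - 2 * beta * om).

Definition c_const (beta om mu : R) (tau l0 : nat) : R :=
  mu * l0%:R /
  (1 + beta * Num.sqrt (mu * l0%:R * (tau%:R + l0%:R - 1)) + beta * om) ^+ 2.

End Constants.

(* Main.v *)
Require Import Defs.
From HB Require Import structures.
From mathcomp Require Import all_boot all_order all_algebra.
From mathcomp Require Import all_classical all_reals all_analysis.
From mathcomp Require Import measurable_realfun.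
From mathcomp Require Import ring lra zify.
Import Order.TTheory GRing.Theory Num.Theory.
Import numFieldNormedType.Exports.

Set Implicit Arguments.
Unset Strict Implicit.
Unset Printing Implicit Defensive.

(** Rescaling by the square root of the diagonal of A reduces the claim to the
    unit-diagonal matrix B = rescaled A.  Let e_j be the rescaled error before
    step j, d_j the direction, K_j the steps missing from the baseline read
    set, and C the matrix B or its block off-diagonal part.  In both memory
    models the iteration becomes
      u_j = B e_j + beta C v_j,   v_j = sum of g_k d_k over k in K_j,
      g_j = the d_j-entry of u_j,  e_{j+1} = e_j - beta g_j d_j
    ([error_trajectory_of]): what the updating node reads afresh in the
    distributed model is exactly what C erases from B.  The gain is that
    neither u_j nor K_j depends on d_j.  Since the directions are independent
    of the schedule, it suffices to bound the error for each fixed schedule,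
    averaged over all finite direction sequences
    ([expectation_uniform_le], [averaged_contraction]).

    Write E_j for the mean of the squared B-norm of e_j, G_j for the mean of
    g_j^2, and q = sqrt rho + rho sqrt tau, so that omega = sqrt tau * q.

    The key estimate ([sumsq_unread_le]) is that the mean of |C v_j|^2 is at
    most n q^2 times the sum of G_k over K_j.  Each term g_k d_k splits into
    its conditional mean u_k / n and a martingale difference.  The conditional
    means are small because the spectral norm of C is at most n rho; the
    differences are orthogonal, so their squares add up without a factor tau.

    Expanding the energy and using Cauchy-Schwarz and AM-GM gives
    ([sqerr_step])
      E_{j+1} <= E_j - beta (2 - beta - beta omega) G_j
                 + (beta^2 omega / tau) (sum of G_k over K_j).
    Adding to E_j the weights that past steps will still contribute in later
    windows gives a potential V_j >= E_j with V_0 = E_0 and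
    V_{j+1} <= V_j - a G_j ([potential_step]).

    It remains to see that a block of N = tau + l0 steps starting at s spends
    enough.  For each of its last l0 steps j, mu E_j is controlled by u_j and
    C v_j, and e_{s+N} differs from e_j by the steps in between; Minkowski's
    inequality over directions and over these j gives
    c E_{s+N} <= sum of G_k over the block ([recovery]).  The penalty part of
    V_{s+N} is at most beta^2 omega times the same sum, hence V contracts over
    the block ([potential_contraction]), at a rate that is at least as good as
    the one claimed. *)

Local Open Scope ring_scope.

(** * Euclidean norms of finite families *)

Lemma discriminant_le (R : realFieldType) (a b c : R) :
  0 <= c -> (forall t, 0 <= a + 2 * t * b + t ^+ 2 * c) -> b ^+ 2 <= a * c.
Proof.
rewrite le0r => /orP[/eqP-> h|c_gt0 h].
  have [->|b0] := eqVneq b 0; first by rewrite mulr0 expr0n.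
  have := h (- (a + 1) / (2 * b)).
  rewrite (_ : a + _ + _ = -1); first by rewrite lerNr oppr0 ler10.
  by field; rewrite ?b0.
have := h (- b / c).
rewrite (_ : a + _ + _ = a - b ^+ 2 / c); last by field; rewrite gt_eqF.
by rewrite subr_ge0 ler_pdivrMr.
Qed.

(** Minkowski's inequality is needed for families indexed jointly by
    direction sequences and by coordinates or time steps; an unweighted norm
    over an arbitrary finite index type covers all these uses, because every
    inequality below is homogeneous in the weights. *)
Section L2.
Variables (R : rcfType) (I : finType).
Implicit Types f g : I -> R.

Definition l2norm f : R := Num.sqrt (\sum_i f i ^+ 2).

Lemma sumsq_ge0 f : 0 <= \sum_i f i ^+ 2.
Proof. by apply: sumr_ge0 => i _; exact: sqr_ge0. Qed.

Lemma l2norm_ge0 f : 0 <= l2norm f. Proof. exact: sqrtr_ge0. Qed.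

Lemma sqr_l2norm f : l2norm f ^+ 2 = \sum_i f i ^+ 2.
Proof. by rewrite sqr_sqrtr ?sumsq_ge0. Qed.

Lemma eq_l2norm f g : f =1 g -> l2norm f = l2norm g.
Proof. by move=> fg; congr Num.sqrt; apply: eq_bigr => i _; rewrite fg. Qed.

Lemma l2norm_le f g : (forall i, `|f i| <= `|g i|) -> l2norm f <= l2norm g.
Proof.
move=> fg; apply: ler_wsqrtr; apply: ler_sum => i _.
by rewrite -(real_normK (num_real (f i))) -(real_normK (num_real (g i))) lerXn2r ?nnegrE.
Qed.

Lemma l2normZ (a : R) f : l2norm (fun i => a * f i) = `|a| * l2norm f.
Proof.
rewrite /l2norm -sqrtr_sqr -sqrtrM ?sqr_ge0 // mulr_sumr.
by congr Num.sqrt; apply: eq_bigr => i _; rewrite exprMn.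
Qed.

Lemma cauchy_schwarz f g : \sum_i f i * g i <= l2norm f * l2norm g.
Proof.
rewrite -sqrtrM ?sumsq_ge0 //; apply: le_trans (ler_norm _) _.
rewrite -sqrtr_sqr ler_wsqrtr // discriminant_le ?sumsq_ge0 // => t.
rewrite (_ : _ + _ + _ = \sum_i (f i + t * g i) ^+ 2) ?sumsq_ge0 //.
rewrite !mulr_sumr -!big_split /=; apply: eq_bigr => i _; ring.
Qed.

Lemma l2normD f g : l2norm (fun i => f i + g i) <= l2norm f + l2norm g.
Proof.
rewrite -(ler_pXn2r (ltn0Sn 1)) ?nnegrE ?addr_ge0 ?l2norm_ge0 //.
rewrite sqrrD !sqr_l2norm.
rewrite (eq_bigr (fun i => f i ^+ 2 + (f i * g i) *+ 2 + g i ^+ 2)); last first.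
  by move=> i _; rewrite sqrrD.
rewrite !big_split /= -mulr2n lerD2r lerD2l lerMn2r /=.
exact: cauchy_schwarz.
Qed.

End L2.

Lemma sqr_sum_le (R : realFieldType) (I : Type) (s : seq I) (P : pred I) (f : I -> R) :
  (\sum_(i <- s | P i) f i) ^+ 2 <= (count P s)%:R * \sum_(i <- s | P i) f i ^+ 2.
Proof.
rewrite mulrC; apply: discriminant_le => [|t]; first exact: ler0n.
rewrite (_ : _ + _ + _ = \sum_(i <- s | P i) (f i + t) ^+ 2).
  by apply: sumr_ge0 => i _; exact: sqr_ge0.
under [RHS]eq_bigr do rewrite sqrrD.
rewrite !big_split /= big_const_seq iter_addr_0 mulr_natr.
rewrite -mulr2n -mulr_suml; ring.
Qed.

(** * Positive semidefinite forms *)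

Section QuadraticForm.
Variables (R : realType) (n : nat).
Implicit Types (M : 'M[R]_n) (u v : 'cV[R]_n).

Definition bform M u v : R := (u^T *m M *m v) 0 0.

Lemma bformDl M u1 u2 v : bform M (u1 + u2) v = bform M u1 v + bform M u2 v.
Proof. by rewrite /bform linearD /= !mulmxDl mxE. Qed.
Lemma bformDr M u v1 v2 : bform M u (v1 + v2) = bform M u v1 + bform M u v2.
Proof. by rewrite /bform mulmxDr mxE. Qed.
Lemma bformZl M a u v : bform M (a *: u) v = a * bform M u v.
Proof. by rewrite /bform linearZ /= -!scalemxAl mxE. Qed.
Lemma bformZr M a u v : bform M u (a *: v) = a * bform M u v.
Proof. by rewrite /bform -scalemxAr mxE. Qed.
Lemma bformC M u v : M^T = M -> bform M u v = bform M v u.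
Proof.
move=> MT; rewrite /bform -[LHS]mulr1 -[in LHS](trmxK (u^T *m M *m v)) mxE mulr1.
by rewrite !trmx_mul trmxK MT mulmxA.
Qed.
Lemma bform_delta M i v : bform M (delta_mx i 0) v = (M *m v) i 0.
Proof. by rewrite /bform -mulmxA trmx_delta -rowE mxE. Qed.
Lemma bform_deltas M i j : bform M (delta_mx i 0) (delta_mx j 0) = M i j.
Proof. by rewrite bform_delta -colE mxE. Qed.
Lemma bform1 u v : bform 1%:M u v = \sum_i u i 0 * v i 0.
Proof. by rewrite /bform mulmx1 mxE; apply: eq_bigr => i _; rewrite mxE. Qed.

Definition psd M := M^T = M /\ forall v, 0 <= bform M v v.

Lemma posdef_psd M : sym_posdef M -> psd M.
Proof.
move=> [MT Mp]; split=> // v; have [->|v0] := eqVneq v 0; last exact/ltW/Mp.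
by rewrite /bform mulmx0 mxE.
Qed.

Lemma psd_cauchy_schwarz M u v : psd M ->
  bform M u v ^+ 2 <= bform M u u * bform M v v.
Proof.
move=> [MT Mp]; apply: discriminant_le => // t.
have := Mp (u + t *: v); rewrite !bformDl !bformDr !bformZl !bformZr (bformC v u MT).
by congr (_ <= _); ring.
Qed.

Lemma sqr_energy_norm M v : psd M -> energy_norm M v ^+ 2 = bform M v v.
Proof. by move=> [_ Mp]; rewrite sqr_sqrtr //; exact: Mp. Qed.

Lemma energy_normD M u v : psd M ->
  energy_norm M (u + v) <= energy_norm M u + energy_norm M v.
Proof.
move=> Mp; rewrite -(ler_pXn2r (ltn0Sn 1)) ?nnegrE ?addr_ge0 ?sqrtr_ge0 //.
rewrite sqrrD !sqr_energy_norm // !bformDl !bformDr (bformC v u Mp.1).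
rewrite (_ : _ + _ + _ = bform M u u + bform M u v *+ 2 + bform M v v); last by ring.
rewrite lerD2r lerD2l lerMn2r /=.
rewrite /energy_norm -sqrtrM; last exact: Mp.2.
by apply: le_trans (ler_norm _) _; rewrite -sqrtr_sqr ler_wsqrtr // psd_cauchy_schwarz.
Qed.

Lemma energy_normZ M a v : energy_norm M (a *: v) = `|a| * energy_norm M v.
Proof.
rewrite /energy_norm -/(bform _ _ _) bformZl bformZr mulrA -expr2.
by rewrite sqrtrM ?sqr_ge0 // sqrtr_sqr.
Qed.

Lemma energy_norm_sum M (I : Type) (s : seq I) (f : I -> 'cV[R]_n) : psd M ->
  energy_norm M (\sum_(i <- s) f i) <= \sum_(i <- s) energy_norm M (f i).
Proof.
move=> Mp; elim/big_rec2: _ => [|i y x _ IH].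
  by rewrite /energy_norm mulmx0 mxE sqrtr0.
exact: le_trans (energy_normD _ _ Mp) (lerD _ _).
Qed.

(** Cauchy-Schwarz for the form, applied to two basis vectors. *)
Lemma psd_entry_le1 M i j : psd M -> (forall k, M k k = 1) -> `|M i j| <= 1.
Proof.
move=> Mp M1; have := psd_cauchy_schwarz (delta_mx i 0) (delta_mx j 0) Mp.
by rewrite !bform_deltas !M1 mulr1 -{1}[1](expr1n _ 2) -ler_sqrt ?ltr01 // !sqrtr_sqr normr1.
Qed.

Lemma bform_bounded M : exists2 C : R, 0 < C &
  forall v, bform M v v <= C * bform 1%:M v v.
Proof.
pose C := \sum_i \sum_j `|M i j|.
have C0 : 0 <= C by do 2!apply: sumr_ge0 => ? _.
exists (C + 1); first by rewrite ltr_wpDl.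
move=> v; set s := bform 1%:M v v.
have s0 : 0 <= s by rewrite /s bform1; apply: sumr_ge0 => i _; rewrite -expr2 sqr_ge0.
have vs i : v i 0 ^+ 2 <= s.
  rewrite /s bform1 (bigD1 i) //= -expr2 lerDl; apply: sumr_ge0 => k _.
  by rewrite -expr2 sqr_ge0.
apply: (@le_trans _ _ (C * s)); last by rewrite ler_wpM2r // lerDl ler01.
have -> : bform M v v = \sum_i \sum_j M i j * (v i 0 * v j 0).
  rewrite /bform -mulmxA mxE; apply: eq_bigr => i _.
  by rewrite !mxE mulr_sumr; apply: eq_bigr => j _; ring.
rewrite /C mulr_suml; apply: ler_sum => i _; rewrite mulr_suml; apply: ler_sum => j _.
apply: le_trans (ler_norm _) _; rewrite normrM ler_wpM2l //.
have := vs i; have := vs j.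
rewrite -(real_normK (num_real (v i 0))) -(real_normK (num_real (v j 0))) normrM.
move: `|v i 0| `|v j 0| => x y ? ?; nra.
Qed.

(** A form that is semidefinite and invertible is uniformly definite.  Applying
    Cauchy-Schwarz for M to v and M^-1 v bounds (v, v)^2 by
    (M v, v) (M^-1 v, v), and the last factor is at most a constant times
    (v, v); this replaces a compactness argument on the unit sphere. *)
Lemma psd_unit_margin M : psd M -> M \in unitmx ->
  exists2 eps : R, 0 < eps & forall v, eps * bform 1%:M v v <= bform M v v.
Proof.
move=> Mp Mu; have [C C0 HC] := bform_bounded (invmx M).
exists C^-1; rewrite ?invr_gt0 // => v; rewrite mulrC ler_pdivrMr // mulrC.
set s := bform 1%:M v v.
have s0 : 0 <= s by rewrite /s bform1; apply: sumr_ge0 => i _; rewrite -expr2 sqr_ge0.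
have := psd_cauchy_schwarz v (invmx M *m v) Mp.
have -> : bform M v (invmx M *m v) = s by rewrite /bform mulmxA mulmxK // /s /bform mulmx1.
have -> : bform M (invmx M *m v) (invmx M *m v) = bform (invmx M) v v.
  by rewrite /bform trmx_mul trmx_inv Mp.1 mulmxKV // mulmxA.
move: (HC v) (Mp.2 v); rewrite -/s; move: (bform M v v) (bform _ v v) => a b ? ? ?.
have [->|sn0] := eqVneq s 0; first by apply: mulr_ge0 => //; exact: ltW.
have spos : 0 < s by rewrite lt0r sn0.
rewrite -(ler_pM2r spos); nra.
Qed.

End QuadraticForm.

(** * The smallest eigenvalue *)

Section LambdaMin.
Variables (R : realType) (n : nat).
Implicit Types (M : 'M[R]_n) (u v : 'cV[R]_n).

Lemma bform1_ge0 v : 0 <= bform 1%:M v v.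
Proof. by rewrite bform1; apply: sumr_ge0 => i _; rewrite -expr2 sqr_ge0. Qed.

Lemma bform1_gt0 v : v != 0 -> 0 < bform 1%:M v v.
Proof.
move=> v0; rewrite lt0r bform1_ge0 andbT; apply: contra_neq v0.
rewrite bform1 => /eqP; rewrite psumr_eq0; last by move=> i _; rewrite -expr2 sqr_ge0.
move=> /allP h; apply/matrixP => i j; rewrite ord1 mxE.
by have := h i (mem_index_enum _); rewrite mulf_eq0 orbb => /eqP.
Qed.

(** The variational description of the smallest eigenvalue, without the
    spectral theorem.  Let t0 be the largest t with M - t I semidefinite.  If
    M - t0 I were invertible it would be uniformly definite
    ([psd_unit_margin]) and t0 could be increased; so t0 is an eigenvalue, and
    no eigenvalue is smaller. *)
Lemma lambda_min_max M : (0 < n)%N -> psd M ->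
  (forall v, lambda_min M * bform 1%:M v v <= bform M v v) /\
  (forall t, (forall v, t * bform 1%:M v v <= bform M v v) -> t <= lambda_min M).
Proof.
move=> n0 Mp; pose i0 : 'I_n := Ordinal n0.
pose E : set R := [set t | forall v, t * bform 1%:M v v <= bform M v v]%classic.
have E0 : E 0 by move=> v; rewrite mul0r; exact: Mp.2.
have Eub : ubound E (M i0 i0).
  by move=> t /(_ (delta_mx i0 0)); rewrite !bform_deltas mxE eqxx mulr1.
have Esup : has_sup E by split; [exists 0|exists (M i0 i0)].
have Emax : E (sup E).
  move=> v; have [->|v0] := eqVneq v 0; first by rewrite /bform !mulmx0 mxE mulr0.
  rewrite -ler_pdivlMr ?bform1_gt0 //; apply: ge_sup; first by exists 0.
  by move=> t Et; rewrite ler_pdivlMr ?bform1_gt0.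
have shift t v : bform (M - t%:M) v v = bform M v v - t * bform 1%:M v v.
  rewrite /bform mulmxBr mulmxBl mxE; congr (_ + _).
  by rewrite -[t%:M]scalemx1 -scalemxAr -scalemxAl !mxE.
have eig : eigenvalue M (sup E).
  apply: contraT => ne.
  have Np : psd (M - (sup E)%:M).
    split; last by move=> v; rewrite shift subr_ge0.
    by rewrite linearB /= Mp.1 tr_scalar_mx.
  have Nu : M - (sup E)%:M \in unitmx.
    by rewrite -row_free_unit -kermx_eq0; move: ne; rewrite /eigenvalue negbK.
  have [eps e0 He] := psd_unit_margin Np Nu.
  have : E (sup E + eps).
    by move=> v; have := He v; rewrite shift mulrDl lerBrDl.
  by move/(ub_le_sup Esup.2); rewrite gerDl leNgt e0.
have lb l : eigenvalue M l -> sup E <= l.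
  move=> /eigenvalueP[v vM v0].
  have vT0 : v^T != 0 by rewrite trmx_eq0.
  have := Emax v^T; rewrite {2}/bform trmxK vM -scalemxAl mxE.
  by rewrite (_ : (v *m v^T) 0 0 = bform 1%:M v^T v^T) ?ler_pM2r ?bform1_gt0 // /bform trmxK mulmx1.
have -> : lambda_min M = sup E.
  apply/eqP; rewrite eq_le; apply/andP; split.
    by apply: ge_inf => //; exists (sup E) => l /= /lb.
  by apply: lb_le_inf; [exists (sup E)|move=> l /= /lb].
by split=> // t Et; exact: (ub_le_sup Esup.2).
Qed.

Lemma lambda_min_gt0 M : (0 < n)%N -> sym_posdef M -> 0 < lambda_min M.
Proof.
move=> n0 Mpd; have Mp := posdef_psd Mpd.
have Mu : M \in unitmx.
  rewrite -row_free_unit -kermx_eq0; apply/rowV0P => v /sub_kermxP vM.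
  apply/eqP; apply: contraT => v0; have := Mpd.2 v^T.
  by rewrite trmx_eq0 => /(_ v0); rewrite trmxK vM mul0mx mxE ltxx.
have [eps e0 He] := psd_unit_margin Mp Mu.
exact: lt_le_trans e0 ((lambda_min_max n0 Mp).2 _ He).
Qed.

(** The energy is controlled by the residual: Cauchy-Schwarz gives
    (M v, v)^2 <= |v|^2 |M v|^2, and lambda_min |v|^2 <= (M v, v). *)
Lemma lambda_min_mul_energy_le M v : (0 < n)%N -> sym_posdef M ->
  lambda_min M * bform M v v <= \sum_i (M *m v) i 0 ^+ 2.
Proof.
move=> n0 Mpd; have Mp := posdef_psd Mpd.
have := (lambda_min_max n0 Mp).1 v; have l0 := lambda_min_gt0 n0 Mpd.
have [->|v0] := eqVneq v 0.
  by rewrite /bform !mulmx0 mxE mulr0 => _; apply: sumr_ge0 => i _; exact: sqr_ge0.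
have Ip : psd (1%:M : 'M[R]_n) by split; [exact: trmx1|exact: bform1_ge0].
have := psd_cauchy_schwarz v (M *m v) Ip; have := bform1_gt0 v0.
rewrite [bform _ v (M *m v)]/bform mulmx1 mulmxA -/(bform M v v).
have -> : bform 1%:M (M *m v) (M *m v) = \sum_i (M *m v) i 0 ^+ 2.
  by rewrite bform1; apply: eq_bigr => i _.
move: (Mpd.2 v v0); rewrite -/(bform M v v).
move: (bform M v v) (bform 1%:M v v) (\sum_i _) (lambda_min M) l0 => a s r l l0.
move=> a0 s0 cs la; rewrite -(ler_pM2l s0); apply: le_trans cs.
by rewrite mulrA (mulrC s) expr2 ler_pM2r.
Qed.

End LambdaMin.

(** * The rescaled error recursion *)

Section Trajectory.
Variables (R : realType) (n : nat) (B C : 'M[R]_n) (beta : R).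
Implicit Types (dir : nat -> 'I_n) (miss : nat -> nat -> bool).
Implicit Types (g : nat -> R) (e : nat -> 'cV[R]_n).

Definition unread miss dir g (j : nat) : 'cV[R]_n :=
  \sum_(0 <= k < j | miss j k) g k *: delta_mx (dir k) 0.

(** The residual seen by the update of step j, before its coordinate is
    selected.  The iterate that is read lacks the contributions of the missing
    steps, hence carries their sum as an additional error. *)
Definition read_residual miss dir e g (j : nat) : 'cV[R]_n :=
  B *m e j + beta *: (C *m unread miss dir g j).

Definition error_trajectory (J : nat) miss (e0 : 'cV[R]_n) dir e g : Prop :=
  e 0%N = e0 /\ forall j, (j < J)%N ->
    g j = read_residual miss dir e g j (dir j) 0 /\
    e j.+1 = e j - (beta * g j) *: delta_mx (dir j) 0.

Lemma unread_eq miss dir dir' g g' j :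
  (forall k, (k < j)%N -> dir k = dir' k /\ g k = g' k) ->
  unread miss dir g j = unread miss dir' g' j.
Proof.
by move=> h; rewrite /unread big_nat_cond [RHS]big_nat_cond; apply: eq_bigr => k /andP[/andP[_ /h[-> ->]]].
Qed.

(** Errors and steps before time j are functions of the directions before j.
    This is all the adaptedness that the martingale argument needs. *)
Lemma trajectory_causal J miss (e0 : 'cV[R]_n) dir dir' e e' g g' j :
  error_trajectory J miss e0 dir e g -> error_trajectory J miss e0 dir' e' g' ->
  (j <= J)%N -> (forall k, (k < j)%N -> dir k = dir' k) ->
  e j = e' j /\ forall k, (k < j)%N -> g k = g' k.
Proof.
move=> [e_0 tr] [e'_0 tr']; elim: j => [|j IH] jJ dd; first by rewrite e_0 e'_0.
have [ej gj] := IH (ltnW jJ) (fun k kj => dd k (ltnW kj)).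
have [g_j e_j] := tr j jJ; have [g'_j e'_j] := tr' j jJ.
have gg : g j = g' j.
  rewrite g_j g'_j /read_residual ej dd // (@unread_eq miss dir dir' g g') // => k kj.
  by rewrite gj // dd // ltnW.
split; first by rewrite e_j e'_j ej gg dd.
by move=> k; rewrite ltnS leq_eqVlt => /orP[/eqP->|/gj].
Qed.

End Trajectory.

(** * Averaging over direction sequences *)

Section Resampling.
Variables (R : realFieldType) (n J : nat).
Local Notation Om := {ffun 'I_J -> 'I_n}.

Definition resample (j : 'I_J) (i : 'I_n) (d : Om) : Om :=
  [ffun k => if k == j then i else d k].

(** Replacing one direction by a fresh uniform one preserves the uniform law:
    exchanging the fresh direction with the discarded one is an involution. *)
Lemma sum_resample j (f : Om -> R) :
  \sum_d \sum_i f (resample j i d) = n%:R * \sum_d f d.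
Proof.
pose swap (p : Om * 'I_n) := (resample j p.2 p.1, p.1 j).
have swapK : involutive swap.
  move=> [d i]; rewrite /swap /=; congr pair; last by rewrite ffunE eqxx.
  by apply/ffunP => k; rewrite !ffunE; case: eqP => // ->.
rewrite pair_bigA (reindex_inj (inv_inj swapK)) /=.
rewrite (eq_bigr (fun p => f p.1)); last first.
  by move=> p _; have := congr1 fst (swapK p) => /= ->.
rewrite -(pair_bigA _ (fun d _ => f d)) /= mulr_sumr; apply: eq_bigr => d _.
by rewrite sumr_const card_ord mulr_natl.
Qed.

(** This plays the role of conditioning on all directions except d_j. *)
Lemma sum_fresh_direction (j : 'I_J) (F : 'I_n -> Om -> R) :
  (forall i i' d, F i (resample j i' d) = F i d) ->
  n%:R * \sum_(d : Om) F (d j) d = \sum_d \sum_i F i d.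
Proof.
move=> hF; rewrite -(sum_resample j); apply: eq_bigr => d _; apply: eq_bigr => i _.
by rewrite ffunE eqxx hF.
Qed.

End Resampling.

Lemma sumsq_orthogonal (R : realFieldType) (I : finType) (K : eqType) (s : seq K)
    (P : pred K) (f : K -> I -> R) : uniq s ->
  (forall k l, k \in s -> l \in s -> P k -> P l -> k != l -> \sum_x f k x * f l x = 0) ->
  \sum_x (\sum_(k <- s | P k) f k x) ^+ 2 = \sum_(k <- s | P k) \sum_x f k x ^+ 2.
Proof.
elim: s => [|k s IH] /=.
  by rewrite big_nil big1 // => x _; rewrite big_nil expr0n.
move=> /andP[ks us] ort; rewrite big_cons.
under eq_bigr do rewrite big_cons.
have IHs := IH us (fun k l kin lin => ort k l (mem_behead (s:=_::_) kin) (mem_behead (s:=_::_) lin)).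
case: ifP => // Pk; under eq_bigr do rewrite sqrrD.
rewrite !big_split /= IHs -mulr2n.
suff -> : \sum_x f k x * (\sum_(l <- s | P l) f l x) = 0 by rewrite mul0rn addr0.
under eq_bigr do rewrite mulr_sumr.
rewrite exchange_big /= big_seq_cond big1 // => l /andP[ls Pl].
by apply: ort; rewrite ?mem_head ?inE ?ls ?orbT //; apply: contraNneq ks => ->.
Qed.

(** Schur's test.  Symmetry makes the bound on columns a bound on rows too, and
    Cauchy-Schwarz with weights |C r t| does the rest. *)
Lemma sumsq_mulmx_le (R : realFieldType) (n : nat) (C : 'M[R]_n) (s : R) (y : 'cV[R]_n) :
  C^T = C -> (forall t, \sum_r `|C r t| <= s) ->
  \sum_r (C *m y) r 0 ^+ 2 <= s ^+ 2 * \sum_r y r 0 ^+ 2.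
Proof.
move=> CT Cs.
have rs r : \sum_t `|C r t| <= s.
  by rewrite -CT; under eq_bigr do rewrite mxE.
case: (posnP n) => [n0|n0].
  have h (i : 'I_n) : False by case: i => m; rewrite n0.
  by rewrite !big1 ?mulr0 // => i; case: (h i).
have s0 : 0 <= s by apply: le_trans (Cs (Ordinal n0)); exact: sumr_ge0.
have row r : (C *m y) r 0 ^+ 2 <= s * \sum_t `|C r t| * y t 0 ^+ 2.
  apply: (@le_trans _ _ ((\sum_t `|C r t|) * \sum_t `|C r t| * y t 0 ^+ 2)); last first.
    by apply: ler_wpM2r => //; apply: sumr_ge0 => t _; rewrite mulr_ge0 ?sqr_ge0.
  rewrite mxE mulrC; apply: discriminant_le => [|t]; first exact: sumr_ge0.
  rewrite !mulr_sumr -!big_split /=; apply: sumr_ge0 => k _.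
  case: (ger0P (C r k)) => c0.
    rewrite (_ : _ + _ = C r k * (y k 0 + t) ^+ 2); last by ring.
    by rewrite mulr_ge0 ?sqr_ge0.
  rewrite (_ : _ + _ = - C r k * (y k 0 - t) ^+ 2); last by ring.
  by rewrite mulr_ge0 ?sqr_ge0 // oppr_ge0 ltW.
apply: (@le_trans _ _ (\sum_r s * \sum_t `|C r t| * y t 0 ^+ 2)); first exact: ler_sum.
rewrite -mulr_sumr expr2 -mulrA ler_wpM2l // exchange_big /= mulr_sumr.
by apply: ler_sum => t _; rewrite -mulr_suml ler_wpM2r ?sqr_ge0.
Qed.

(** * Descent with delayed penalties *)

(** In the application E is the mean squared error and G the mean squared
    step.  A step decreases E by b G but suffers a penalty h G_k for each recent
    step k that it has not read. *)
Section DelayedDescent.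
Variables (R : realFieldType) (E G : nat -> R) (miss : nat -> nat -> bool).
Variables (tau l0 J : nat) (b h c : R).
Hypothesis E_ge0 : forall j, 0 <= E j.
Hypothesis G_ge0 : forall j, 0 <= G j.
Hypothesis h_ge0 : 0 <= h.
Hypothesis c_gt0 : 0 < c.
Hypothesis miss_recent : forall j k, miss j k -> (j < k + tau)%N.
Hypothesis descent : forall j, (j < J)%N ->
  E j.+1 <= E j - b * G j + h * \sum_(0 <= k < j | miss j k) G k.
Hypothesis productive : forall s, (s + tau + l0 <= J)%N ->
  c * E (s + tau + l0)%N <= \sum_(s <= k < s + tau + l0) G k.

(** The weight k + tau - j is truncated at 0.  It is the number of times from j
    on at which step k may still be missing, so the potential pays all
    outstanding penalties in advance. *)
Definition potential (j : nat) : R :=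
  E j + h * \sum_(0 <= k < j) (k + tau - j)%N%:R * G k.

Let a := b - h * tau%:R.

Lemma potential_ge j : E j <= potential j.
Proof.
rewrite lerDl mulr_ge0 //; apply: sumr_ge0 => k _; by rewrite mulr_ge0.
Qed.

Lemma potential_step j : (j < J)%N -> potential j.+1 <= potential j - a * G j.
Proof.
move=> jJ; rewrite /potential big_nat_recr //= mulrDr.
apply: le_trans (lerD (descent jJ) (lexx _)) _.
have -> : E j - b * G j + h * \sum_(0 <= k < j | miss j k) G k +
    (h * \sum_(0 <= k < j) (k + tau - j.+1)%N%:R * G k + h * ((j + tau - j.+1)%N%:R * G j)) =
    E j - b * G j + (h * (\sum_(0 <= k < j | miss j k) G k +
      \sum_(0 <= k < j) (k + tau - j.+1)%N%:R * G k) + h * ((j + tau - j.+1)%N%:R * G j)).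
  by ring.
have -> : E j + h * \sum_(0 <= k < j) (k + tau - j)%N%:R * G k - a * G j =
    E j - b * G j + (h * (\sum_(0 <= k < j) (k + tau - j)%N%:R * G k) + h * (tau%:R * G j)).
  by rewrite /a; ring.
rewrite lerD2l; apply: lerD; rewrite ler_wpM2l //; last first.
  by rewrite ler_wpM2r // ler_nat; lia.
rewrite big_mkcond -big_split /=; apply: ler_sum => k _.
case: ifP => [/miss_recent jk|_]; last by rewrite add0r ler_wpM2r // ler_nat; lia.
by rewrite -[X in X + _]mul1r -mulrDl ler_wpM2r // nat1r ler_nat; lia.
Qed.

Lemma potential_drop s l : (s + l <= J)%N ->
  potential (s + l) <= potential s - a * \sum_(s <= k < s + l) G k.
Proof.
elim: l => [|l IH]; first by rewrite addn0 big_geq // mulr0 subr0.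
rewrite addnS => slJ; apply: le_trans (potential_step slJ) _.
by rewrite big_nat_recr ?leq_addr //= mulrDr opprD addrA lerD2r IH // ltnW.
Qed.

(** After a block of length at least tau, no step that precedes the block can be
    missing any longer, so all outstanding penalties come from the block. *)
Lemma potential_tail s :
  potential (s + tau + l0) <=
  E (s + tau + l0)%N + h * tau%:R * \sum_(s <= k < s + tau + l0) G k.
Proof.
rewrite lerD2l -mulrA ler_wpM2l // mulr_sumr.
rewrite (@big_cat_nat _ _ _ s) //=; last by rewrite -addnA leq_addr.
rewrite big_nat big1 ?add0r => [|k /andP[_ ks]].
  by rewrite big_nat [leRHS]big_nat; apply: ler_sum => k /andP[_ ks]; rewrite ler_wpM2r // ler_nat; lia.
by rewrite (_ : (_ - _)%N = 0%N) ?mul0r //; lia.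
Qed.

(** The block removes a W from the potential, W being the total of G over it,
    while c times what remains is at most (1 + h tau c) W.  The argument bounds
    the potential after the block rather than before it, because the potential
    before the block involves steps that lie outside. *)
Lemma potential_contraction s D : 0 < a ->
  (s + tau + l0 <= J)%N -> 1 + a * c + h * tau%:R * c <= D ->
  potential (s + tau + l0) <= (1 - a * c / D) * potential s.
Proof.
move=> a_gt0 sJ hD.
have := potential_tail s; have := productive sJ.
have : potential (s + tau + l0) <= potential s - a * \sum_(s <= k < s + tau + l0) G k.
  by move: (@potential_drop s (tau + l0)); rewrite addnA; exact.
have V0 : 0 <= potential s by apply: le_trans (potential_ge s).
have D_gt0 : 0 < D by apply: lt_le_trans hD; rewrite -addrA ltr_wpDr // addr_ge0 // !mulr_ge0 // ltW.
move: (potential _) (potential s) V0 (\sum_(s <= k < _) G k) (E _) => V' V V0 W E'.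
move=> hV hE hV'; rewrite mulrBl mul1r lerBrDr -lerBrDl.
rewrite mulrAC ler_pdivrMr //.
have h1 : c * V' <= (1 + h * tau%:R * c) * W.
  apply: le_trans (ler_wpM2l (ltW c_gt0) hV') _; rewrite mulrDr mulrDl mul1r.
  by apply: lerD => //; rewrite le_eqVlt; apply/orP; left; apply/eqP; ring.
have H0 : 0 <= 1 + h * tau%:R * c by rewrite addr_ge0 // !mulr_ge0 // ltW.
have h2 : a * c * V' <= (1 + h * tau%:R * c) * (V - V').
  apply: (@le_trans _ _ ((1 + h * tau%:R * c) * (a * W))); last by rewrite ler_wpM2l // lerBrDr -lerBrDl.
  by rewrite -mulrA [leRHS]mulrCA ler_pM2l.
have ac_gt0 : 0 < a * c by rewrite mulr_gt0.
have h3 : a * c * V <= (1 + a * c + h * tau%:R * c) * (V - V').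
  rewrite (_ : 1 + _ + _ = 1 + h * tau%:R * c + a * c); last by ring.
  by rewrite [leRHS]mulrDl -lerBlDr -mulrBr subKr.
have VV' : 0 <= V - V'.
  have H1 : 0 < 1 + a * c + h * tau%:R * c by rewrite addrAC ltr_wpDl.
  by rewrite -(pmulr_rge0 _ H1); apply: le_trans h3; rewrite mulr_ge0 // ltW.
apply: le_trans h3 _; rewrite mulrC ler_wpM2l //.
Qed.

Lemma delayed_descent_rate D t : 0 < a -> (0 < l0)%N ->
  (t * (tau + l0) <= J)%N -> 1 + a * c + h * tau%:R * c <= D ->
  E (t * (tau + l0))%N <= (1 - a * c / D) ^+ t * E 0%N.
Proof.
move=> a_gt0 l0_gt0 tJ hD; apply: le_trans (potential_ge _) _.
have -> : E 0%N = potential 0 by rewrite /potential big_geq // mulr0 addr0.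
have ac_gt0 : 0 < a * c by rewrite mulr_gt0.
have D_gt0 : 0 < D.
  by apply: lt_le_trans hD; rewrite -addrA ltr_wpDr // addr_ge0 ?(ltW ac_gt0) // !mulr_ge0 // ltW.
have rate_ge0 : 0 <= 1 - a * c / D.
  rewrite subr_ge0 ler_pdivrMr // mul1r; apply: le_trans hD.
  by rewrite addrAC lerDr addr_ge0 // !mulr_ge0 // ltW.
elim: t tJ => [|t IH] tJ; first by rewrite mul0n expr0 mul1r.
have -> : (t.+1 * (tau + l0) = t * (tau + l0) + tau + l0)%N by lia.
apply: le_trans (potential_contraction a_gt0 _ hD) _; first by lia.
by rewrite exprS -[leRHS]mulrA ler_wpM2l // IH //; lia.
Qed.

End DelayedDescent.

(** * Convergence for a fixed schedule *)

Lemma count_window (P : pred nat) (tau c a b : nat) :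
  (forall k, (k < b)%N -> P k -> (c <= k < c + tau)%N) -> (count P (index_iota a b) <= tau)%N.
Proof.
move=> hP; rewrite -size_filter -[leqRHS](size_iota c); apply: uniq_leq_size.
  by rewrite filter_uniq ?iota_uniq.
move=> k; rewrite mem_filter mem_index_iota mem_iota => /and3P[Pk _ kb]; exact: hP.
Qed.

Lemma sum_ord_shift (V : nmodType) (a l : nat) (f : nat -> V) :
  \sum_(i < l) f (i + a)%N = \sum_(a <= j < a + l) f j.
Proof. by rewrite -{2}[a]add0n big_addn addKn big_mkord. Qed.

(** All averages over direction sequences are unnormalised sums: the normalising
    constant is the same in every term.  B is the rescaled matrix, C its
    part seen by missing steps, and [dir d] is an infinite sequence of which
    only the first J entries, those of d, matter. *)
Section AveragedDescent.
Variables (R : realType) (n : nat) (B C : 'M[R]_n) (beta rho : R) (tau J : nat).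
Variables (miss : nat -> nat -> bool) (e0 : 'cV[R]_n).
Local Notation Om := {ffun 'I_J -> 'I_n}.
Variables (dir : Om -> nat -> 'I_n) (e : Om -> nat -> 'cV[R]_n) (g : Om -> nat -> R).

Hypothesis dirE : forall d (k : 'I_J), dir d k = d k.
Hypothesis traj :
  forall d, error_trajectory B C beta J miss e0 (dir d) (e d) (g d).
Hypothesis n_gt0 : (0 < n)%N.
Hypothesis B_pd : sym_posdef B.
Hypothesis B_diag : forall i, B i i = 1.
Hypothesis C_sym : C^T = C.
Hypothesis C_entry : forall r t, `|C r t| <= 1.
Hypothesis C_col : forall t, \sum_r `|C r t| <= n%:R * rho.
Hypothesis rho_ge0 : 0 <= rho.
Hypothesis beta_gt0 : 0 < beta.
Hypothesis tau_gt0 : (0 < tau)%N.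
Hypothesis missW : forall j k, miss j k -> (j < k + tau)%N.

Definition sqstep (j : nat) : R := \sum_d g d j ^+ 2.
Definition sqerr (j : nat) : R := \sum_d bform B (e d j) (e d j).
Definition unread_sqstep (j : nat) : R := \sum_(0 <= k < j | miss j k) sqstep k.
(** The factor q for which omega = sqrt tau * q; see [sumsq_unread_le]. *)
Definition spread : R := Num.sqrt rho + rho * Num.sqrt tau%:R.

Let u d j := read_residual B C beta miss (dir d) (e d) (g d) j.
Let v d j := unread miss (dir d) (g d) j.

Let nR_gt0 : 0 < n%:R :> R. Proof. by rewrite ltr0n. Qed.
Let B_psd := posdef_psd B_pd.

Lemma sqstep_ge0 j : 0 <= sqstep j.
Proof. by apply: sumr_ge0 => d _; exact: sqr_ge0. Qed.

Lemma sqerr_ge0 j : 0 <= sqerr j.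
Proof. by apply: sumr_ge0 => d _; exact: B_psd.2. Qed.

Lemma unread_sqstep_ge0 j : 0 <= unread_sqstep j.
Proof. by apply: sumr_ge0 => k _; exact: sqstep_ge0. Qed.

Lemma spread_ge0 : 0 <= spread.
Proof. by rewrite addr_ge0 ?mulr_ge0 ?sqrtr_ge0. Qed.

Lemma omega_spread : omega rho tau = Num.sqrt tau%:R * spread.
Proof.
rewrite /omega /spread mulrDr sqrtrM // (mulrC (Num.sqrt rho)); congr (_ + _).
by rewrite mulrCA -expr2 sqr_sqrtr.
Qed.

Lemma resample_past (l : 'I_J) i d j : (j <= l)%N ->
  e (resample l i d) j = e d j /\
  forall k, (k < j)%N -> g (resample l i d) k = g d k /\
                       dir (resample l i d) k = dir d k.
Proof.
move=> jl; have jJ : (j <= J)%N by rewrite (leq_trans jl) // ltnW.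
have dd k : (k < j)%N -> dir (resample l i d) k = dir d k.
  move=> kj; have kJ : (k < J)%N := leq_trans kj jJ.
  have -> : k = Ordinal kJ by [].
  by rewrite !dirE ffunE ifN // -val_eqE /= neq_ltn (leq_trans kj jl).
have [he hg] := trajectory_causal (traj (resample l i d)) (traj d) jJ dd.
by split=> // k kj; rewrite hg // dd.
Qed.

Lemma resample_unread (l : 'I_J) i d j : (j <= l)%N ->
  v (resample l i d) j = v d j.
Proof.
move=> jl; apply: unread_eq => k kj.
by have [_ /(_ k kj)[-> ->]] := resample_past i d jl.
Qed.

Lemma resample_residual (l : 'I_J) i d j : (j <= l)%N ->
  u (resample l i d) j = u d j.
Proof.
move=> jl; rewrite /u /read_residual -!/(v _ _) resample_unread //.
by have [-> _] := resample_past i d jl.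
Qed.

Lemma stepE d (j : 'I_J) : g d j = u d j (d j) 0.
Proof. by have [_ /(_ j (ltn_ord j))[-> _]] := traj d; rewrite dirE. Qed.

(** Averaging over d_j first: g_j is a uniformly chosen entry of u_j, and u_j
    does not depend on d_j. *)
Lemma sqstep_residual (j : 'I_J) :
  n%:R * sqstep j = \sum_d \sum_i u d j i 0 ^+ 2.
Proof.
rewrite /sqstep; under eq_bigr do rewrite stepE.
apply: (sum_fresh_direction (F := fun i d => u d j i 0 ^+ 2)) => i i' d.
by rewrite resample_residual.
Qed.

(* [impulse k] is the contribution of step k to C v_j as a function of the
   directions and of a coordinate, [drift k] is its conditional mean given the
   directions before k, and [noise k] is the remaining martingale difference. *)
Let impulse k (p : Om * 'I_n) := C p.2 (dir p.1 k) * g p.1 k.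
Let drift k (p : Om * 'I_n) := n%:R^-1 * (C *m u p.1 k) p.2 0.
Let noise k p := impulse k p - drift k p.

(** The martingale property: the noise of step l is orthogonal to everything
    that does not depend on d_l. *)
Lemma noise_uncorrelated (l : 'I_J) r (f : Om -> R) :
  (forall i d, f (resample l i d) = f d) -> \sum_d f d * noise l (d, r) = 0.
Proof.
move=> hf; under eq_bigr do rewrite /noise mulrBr.
rewrite sumrB; apply/eqP; rewrite subr_eq0; apply/eqP.
apply: (@mulfI _ n%:R); first by rewrite gt_eqF.
pose F i d := f d * (C r i * u d l i 0).
have -> : \sum_d f d * impulse l (d, r) = \sum_(d : Om) F (d l) d.
  by apply: eq_bigr => d _; rewrite /impulse /= dirE stepE.
rewrite (sum_fresh_direction (F := F)); last first.
  by move=> i i' d; rewrite /F hf resample_residual.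
rewrite mulr_sumr; apply: eq_bigr => d _; rewrite /F -mulr_sumr /drift /= [in RHS]mxE.
by field; rewrite gt_eqF.
Qed.

Lemma resample_drift (l : 'I_J) i d r k : (k <= l)%N ->
  drift k (resample l i d, r) = drift k (d, r).
Proof. by move=> kl; rewrite /drift /= resample_residual. Qed.

Lemma resample_noise (l : 'I_J) i d r k : (k < l)%N ->
  noise k (resample l i d, r) = noise k (d, r).
Proof.
move=> kl; rewrite /noise resample_drift ?(ltnW kl) // /impulse /=.
by have [_ /(_ k (ltnSn k))[-> ->]] := resample_past i d kl.
Qed.

(** A fluctuation has at most the second moment of the whole.  The latter is
    g_l^2 times the squared norm of a column of C, which is at most the
    column's absolute sum because the entries are at most 1. *)
Lemma sumsq_noise (l : 'I_J) : \sum_p noise l p ^+ 2 <= n%:R * rho * sqstep l.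
Proof.
apply: (@le_trans _ _ (\sum_p impulse l p ^+ 2)).
  rewrite -subr_ge0 -sumrB.
  rewrite (_ : \sum_p _ = \sum_p drift l p ^+ 2 + 2 * \sum_p drift l p * noise l p).
    rewrite [X in 2 * X](_ : _ = 0) ?mulr0 ?addr0 ?sumsq_ge0 //.
    rewrite -(pair_bigA _ (fun d r => drift l (d, r) * noise l (d, r))) exchange_big /=.
    rewrite big1 // => r _; apply: noise_uncorrelated => i d; exact: resample_drift.
  rewrite mulr_sumr -big_split /=; apply: eq_bigr => p _; rewrite /noise; ring.
rewrite -(pair_bigA _ (fun d r => impulse l (d, r) ^+ 2)) mulr_sumr /=.
apply: ler_sum => d _; rewrite /impulse /=; under eq_bigr do rewrite exprMn.
rewrite -mulr_suml ler_wpM2r ?sqr_ge0 //; apply: le_trans (C_col (dir d l)).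
apply: ler_sum => r _; rewrite -(real_normK (num_real _)) expr2.
by rewrite ler_piMr.
Qed.

Lemma unread_drift_noise j p : (C *m v p.1 j) p.2 0 =
  (\sum_(0 <= k < j | miss j k) drift k p) + \sum_(0 <= k < j | miss j k) noise k p.
Proof.
rewrite -big_split /= /v /unread mulmx_sumr summxE; apply: eq_bigr => k _.
by rewrite /noise addrC subrK -scalemxAr mxE -colE mxE mulrC.
Qed.

Lemma l2norm_noise j : (j < J)%N ->
  l2norm (fun p => \sum_(0 <= k < j | miss j k) noise k p)
    <= Num.sqrt (n%:R * rho * unread_sqstep j).
Proof.
move=> jJ; rewrite /l2norm ler_wsqrtr //.
rewrite sumsq_orthogonal ?iota_uniq //; last first.
  suff ort k l : (k < l)%N -> (l < j)%N -> \sum_x noise k x * noise l x = 0.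
    move=> k l; rewrite !mem_index_iota => /andP[_ kj] /andP[_ lj] _ _.
    rewrite neq_ltn => /orP[kl|lk]; first exact: ort.
    by under eq_bigr do rewrite mulrC; exact: ort.
  move=> kl lj; rewrite -(pair_bigA _ (fun d r => noise k (d, r) * noise l (d, r))).
  rewrite exchange_big big1 // => r _ /=.
  by apply: (@noise_uncorrelated (Ordinal (ltn_trans lj jJ))) => i d; exact: resample_noise.
rewrite /unread_sqstep mulr_sumr big_nat_cond [leRHS]big_nat_cond; apply: ler_sum => k /andP[/andP[_ kj] _].
exact: (sumsq_noise (Ordinal (ltn_trans kj jJ))).
Qed.

(** The drift of v_j is the mean residual, to which C applies with spectral
    norm at most n rho; summing at most tau of them costs a factor tau. *)
Lemma l2norm_drift j : (j < J)%N ->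
  l2norm (fun p => \sum_(0 <= k < j | miss j k) drift k p)
    <= rho * Num.sqrt tau%:R * Num.sqrt (n%:R * unread_sqstep j).
Proof.
move=> jJ; rewrite -[rho]ger0_norm // -sqrtr_sqr -!sqrtrM ?sqr_ge0 ?mulr_ge0 ?sqr_ge0 //.
rewrite /l2norm ler_wsqrtr //.
pose U d := \sum_(0 <= k < j | miss j k) u d k.
rewrite -(pair_bigA _ (fun d r => (\sum_(0 <= k < j | miss j k) drift k (d, r)) ^+ 2)) /=.
apply: (@le_trans _ _ (\sum_d rho ^+ 2 * \sum_r U d r 0 ^+ 2)).
  apply: ler_sum => d _.
  have -> : \sum_r (\sum_(0 <= k < j | miss j k) drift k (d, r)) ^+ 2 =
            n%:R^-1 ^+ 2 * \sum_r (C *m U d) r 0 ^+ 2.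
    rewrite mulr_sumr; apply: eq_bigr => r _; rewrite -exprMn /U mulmx_sumr summxE mulr_sumr.
    by congr (_ ^+ 2); apply: eq_bigr.
  rewrite exprVn mulrC ler_pdivrMr ?exprn_gt0 //.
  apply: le_trans (sumsq_mulmx_le (U d) C_sym C_col) _.
  by rewrite exprMn le_eqVlt; apply/orP; left; apply/eqP; ring.
rewrite -mulr_sumr -mulrA ler_wpM2l ?sqr_ge0 //.
apply: (@le_trans _ _ (\sum_d \sum_r tau%:R * \sum_(0 <= k < j | miss j k) u d k r 0 ^+ 2)).
  apply: ler_sum => d _; apply: ler_sum => r _; rewrite /U summxE.
  apply: le_trans (sqr_sum_le _ _ _) _; rewrite ler_wpM2r //.
    by apply: sumr_ge0 => k _; exact: sqr_ge0.
  rewrite ler_nat (@count_window _ _ (j - tau)) // => k kj /missW; lia.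
have -> : n%:R * unread_sqstep j = \sum_(0 <= k < j | miss j k) \sum_d \sum_r u d k r 0 ^+ 2.
  rewrite /unread_sqstep mulr_sumr big_nat_cond [RHS]big_nat_cond; apply: eq_bigr => k.
  move=> /andP[/andP[_ kj] _].
  exact: (sqstep_residual (Ordinal (ltn_trans kj jJ))).
rewrite [X in _ <= _ * X]exchange_big mulr_sumr /=; apply: ler_sum => d _.
by rewrite [X in _ <= _ * X]exchange_big mulr_sumr.
Qed.

(** The noise contributes sqrt rho to the spread and the drift rho sqrt tau.
    A direct triangle inequality over the missing steps would cost an extra
    sqrt tau on the first term. *)
Lemma sumsq_unread_le j : (j < J)%N ->
  \sum_d \sum_r (C *m v d j) r 0 ^+ 2 <= n%:R * spread ^+ 2 * unread_sqstep j.
Proof.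
move=> jJ; rewrite (pair_bigA _ (fun d r => (C *m v d j) r 0 ^+ 2)) /=.
rewrite -[X in X <= _](sqr_l2norm (fun p => (C *m v p.1 j) p.2 0)).
rewrite -[unread_sqstep j]sqr_sqrtr ?unread_sqstep_ge0 // -(sqr_sqrtr (ltW nR_gt0)) -!exprMn.
rewrite lerXn2r ?nnegrE ?l2norm_ge0 ?mulr_ge0 ?sqrtr_ge0 ?spread_ge0 //.
rewrite (eq_l2norm (unread_drift_noise j)); apply: le_trans (l2normD _ _) _.
apply: le_trans (lerD (l2norm_drift jJ) (l2norm_noise jJ)) _.
rewrite !sqrtrM ?mulr_ge0 ?(ltW nR_gt0) // /spread le_eqVlt; apply/orP; left; apply/eqP.
by ring.
Qed.

(** Cauchy-Schwarz first, then averaging over d_j in the second factor, since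
    C v_j does not depend on d_j. *)
Lemma cross_term_le (j : 'I_J) :
  \sum_d g d j * (C *m v d j) (d j) 0 <= Num.sqrt (sqstep j) * (spread * Num.sqrt (unread_sqstep j)).
Proof.
apply: le_trans (cauchy_schwarz _ _) _; apply: ler_wpM2l; first exact: l2norm_ge0.
rewrite -(ger0_norm spread_ge0) -sqrtr_sqr -sqrtrM ?sqr_ge0 //; apply: ler_wsqrtr.
rewrite -(ler_pM2l nR_gt0).
rewrite (sum_fresh_direction (F := fun i d => (C *m v d j) i 0 ^+ 2)).
  by rewrite mulrA; exact: sumsq_unread_le.
by move=> i i' d; rewrite resample_unread.
Qed.

(** With [(B e_j)_(d_j) = g_j - beta (C v_j)_(d_j)], the energy changes by
    - beta (2 - beta) g_j^2 + 2 beta^2 g_j (C v_j)_(d_j); the last term is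
    bounded by [cross_term_le]. *)
Lemma sqerr_step j : (j < J)%N ->
  sqerr j.+1 <= sqerr j - beta * (2 - beta - beta * omega rho tau) * sqstep j
                + beta ^+ 2 * omega rho tau / tau%:R * unread_sqstep j.
Proof.
move=> jJ; pose oj := Ordinal jJ.
have step d : bform B (e d j.+1) (e d j.+1) =
    bform B (e d j) (e d j) - beta * (2 - beta) * g d j ^+ 2
    + 2 * beta ^+ 2 * (g d j * (C *m v d j) (d oj) 0).
  have [_ /(_ j jJ)[_ ->]] := traj d.
  rewrite -[- (_ *: _)]scaleNr bformDl !bformDr !bformZl !bformZr (bformC (e d j) _ B_psd.1).
  rewrite bform_delta bform_deltas B_diag (dirE d oj).
  have -> : (B *m e d j) (d oj) 0 = g d j - beta * (C *m v d j) (d oj) 0.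
    by rewrite (stepE d oj) /u /read_residual !mxE addrK.
  ring.
rewrite /sqerr; under eq_bigr do rewrite step.
rewrite !big_split /= sumrN -!mulr_sumr -/(sqerr j) -/(sqstep j).
rewrite -!addrA lerD2l.
have := cross_term_le oj; move: (\sum_d _) => X /= hX.
have x2 := sqr_sqrtr (sqstep_ge0 j); have y2 := sqr_sqrtr (unread_sqstep_ge0 j).
move: hX x2 y2; move: (Num.sqrt _) (Num.sqrt (unread_sqstep j)) => x y hX <- <-.
have w_gt0 : 0 < Num.sqrt (tau%:R : R) by rewrite sqrtr_gt0 ltr0n.
have tauE := esym (sqr_sqrtr (ler0n R tau)); rewrite omega_spread.
move: (Num.sqrt tau%:R) w_gt0 tauE => w w_gt0 ->.
(* AM-GM as 2 x y <= w x^2 + y^2 / w with w = sqrt tau: summed over a window of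
   length tau, the two terms on the right then carry equal weight. *)
rewrite -subr_ge0 (_ : _ - _ = beta ^+ 2 * (spread * w * (x - y / w) ^+ 2
    + 2 * (x * (spread * y) - X))); last by field; rewrite gt_eqF.
apply: mulr_ge0; first exact: sqr_ge0.
apply: addr_ge0; last by rewrite mulr_ge0 // subr_ge0.
by apply: mulr_ge0; [rewrite mulr_ge0 ?spread_ge0 // ltW|exact: sqr_ge0].
Qed.

Definition sum_sqstep (s s' : nat) : R := \sum_(s <= k < s') sqstep k.

Lemma sum_sqstep_ge0 s s' : 0 <= sum_sqstep s s'.
Proof. by apply: sumr_ge0 => k _; exact: sqstep_ge0. Qed.

Let mu := lambda_min B / n%:R.

(** Directions have unit energy norm because B has unit diagonal. *)
Lemma displacement_le d (j s : nat) : (j <= s <= J)%N ->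
  energy_norm B (e d s) <= energy_norm B (e d j) + beta * \sum_(j <= k < s) `|g d k|.
Proof.
move=> /andP[js sJ]; have [_ tr] := traj d.
have -> : e d s = e d j + - \sum_(j <= k < s) (beta * g d k) *: delta_mx (dir d k) 0.
  elim: s js sJ => [|s IH]; first by rewrite leqn0 => /eqP-> _; rewrite big_geq // oppr0 addr0.
  rewrite leq_eqVlt => /orP[/eqP<- _|]; first by rewrite big_geq // oppr0 addr0.
  rewrite ltnS => js sJ; rewrite big_nat_recr //= opprD addrA -IH ?(ltnW sJ) //.
  by have [_ ->] := tr s sJ.
apply: le_trans (energy_normD _ _ B_psd) _; rewrite lerD2l.
rewrite -scaleN1r energy_normZ normrN1 mul1r.
apply: le_trans (energy_norm_sum _ _ B_psd) _; rewrite mulr_sumr le_eqVlt.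
apply/orP; left; apply/eqP; apply: eq_bigr => k _.
rewrite energy_normZ normrM (gtr0_norm beta_gt0) /energy_norm.
by rewrite -/(bform _ _ _) bform_deltas B_diag sqrtr1 mulr1.
Qed.

Lemma mu_gt0 : 0 < mu.
Proof. by rewrite divr_gt0 // lambda_min_gt0. Qed.

Lemma energy_le_residual d j :
  Num.sqrt mu * energy_norm B (e d j) <=
  (Num.sqrt n%:R)^-1 * (l2norm (fun i => u d j i 0) + beta * l2norm (fun i => (C *m v d j) i 0)).
Proof.
apply: (@le_trans _ _ ((Num.sqrt n%:R)^-1 * l2norm (fun i => (B *m e d j) i 0))).
  rewrite /energy_norm -sqrtrM ?(ltW mu_gt0) // -sqrtrV // -sqrtrM ?invr_ge0 //.
  apply: ler_wsqrtr; rewrite /mu mulrAC mulrC ler_wpM2l ?invr_ge0 //.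
  exact: lambda_min_mul_energy_le.
rewrite ler_wpM2l ?invr_ge0 ?sqrtr_ge0 //.
have -> : l2norm (fun i => (B *m e d j) i 0) =
    l2norm (fun i => u d j i 0 + - beta * (C *m v d j) i 0).
  by apply: eq_l2norm => i; rewrite /u /read_residual !mxE mulNr addrK.
by apply: le_trans (l2normD _ _) _; rewrite l2normZ normrN (gtr0_norm beta_gt0).
Qed.


(** Each step is missing from fewer than tau read sets, and only steps from s
    on can be missing at times s + tau and later. *)
Lemma sum_unread_sqstep_le (s l : nat) :
  \sum_(s + tau <= j < s + tau + l) unread_sqstep j <= tau%:R * sum_sqstep s (s + tau + l).
Proof.
pose near j k := (k < j < k + tau)%N.
apply: (@le_trans _ _ (\sum_(s + tau <= j < s + tau + l)
    \sum_(s <= k < s + tau + l | near j k) sqstep k)).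
  rewrite big_nat_cond [leRHS]big_nat_cond; apply: ler_sum => j /andP[/andP[sj jl] _].
  rewrite /unread_sqstep (@big_cat_nat _ _ _ s) ?(leq_trans (leq_addr _ _) sj) //=.
  rewrite big_nat_cond big_pred0 ?add0r; last first.
    by move=> k; apply/negbTE/negP => /andP[/andP[_ ks] /missW]; lia.
  rewrite [leRHS](@big_cat_nat _ _ _ j) ?(ltnW jl) ?(leq_trans (leq_addr _ _) sj) //=.
  rewrite -[leLHS]addr0; apply: lerD; last by apply: sumr_ge0 => k _; exact: sqstep_ge0.
  rewrite big_nat_cond big_mkcond [leRHS]big_nat_cond [leRHS]big_mkcond.
  apply: ler_sum => k _; rewrite /near.
  case: (boolP (_ && miss j k)) => [/andP[/andP[sk kj] /missW ->]|_].
    by rewrite sk kj.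
  by case: ifP => // _; exact: sqstep_ge0.
rewrite (exchange_big_dep xpredT) //= /sum_sqstep mulr_sumr; apply: ler_sum => k _.
rewrite big_const_seq iter_addr_0 -[leLHS]mulr_natl ler_wpM2r ?sqstep_ge0 // ler_nat.
by apply: (@count_window _ _ k) => j _; rewrite /near; lia.
Qed.

(** A large error at the end of a block forces large steps in it.  For a time
    j in the last l0 steps of the block, the pointwise bound [F0 <= F1 + beta F2
    + beta F3] compares the final energy norm with the residual u_j, the
    missing part C v_j and the displacement between j and the end.  The norms
    of F1, F2, F3 over all directions and all such j give, in this order, the
    terms 1, beta omega and beta sqrt (mu l0 (tau + l0 - 1)). *)
Lemma recovery (s l0 : nat) : (0 < l0)%N -> (s + tau + l0 <= J)%N ->
  mu * l0%:R * sqerr (s + tau + l0) <=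
  (1 + beta * Num.sqrt (mu * l0%:R * (tau%:R + l0%:R - 1)) + beta * omega rho tau) ^+ 2
  * sum_sqstep s (s + tau + l0).
Proof.
move=> l0_gt0; set s' := (s + tau + l0)%N => s'J.
pose J' (i : 'I_l0) : nat := (i + (s + tau))%N.
have J's i : (s + tau <= J' i < s')%N by rewrite /J' /s'; have := ltn_ord i; lia.
have J'J i : (J' i < J)%N by have := J's i; lia.
set w := sum_sqstep s s'; have w0 : 0 <= w := sum_sqstep_ge0 _ _.
pose F0 (p : Om * 'I_l0) := Num.sqrt mu * energy_norm B (e p.1 s').
pose F1 (p : Om * 'I_l0) := (Num.sqrt n%:R)^-1 * l2norm (fun r => u p.1 (J' p.2) r 0).
pose F2 (p : Om * 'I_l0) := (Num.sqrt n%:R)^-1 * l2norm (fun r => (C *m v p.1 (J' p.2)) r 0).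
pose F3 (p : Om * 'I_l0) := Num.sqrt mu * \sum_(J' p.2 <= k < s') `|g p.1 k|.
have pos p : F0 p <= F1 p + (beta * F2 p + beta * F3 p).
  rewrite /F0 /F1 /F2 /F3; have /andP[_ js'] := J's p.2.
  have js'J : (J' p.2 <= s' <= J)%N by rewrite (ltnW js').
  have := displacement_le p.1 js'J; have := energy_le_residual p.1 (J' p.2).
  move: (sqrtr_ge0 mu) => m0 h1 h2.
  apply: le_trans (ler_wpM2l m0 h2) _; rewrite mulrDr.
  apply: le_trans (lerD h1 (lexx _)) _.
  by rewrite le_eqVlt; apply/orP; left; apply/eqP; ring.
have F0E : l2norm F0 = Num.sqrt (mu * l0%:R * sqerr s').
  congr Num.sqrt; rewrite -(pair_bigA _ (fun d i => F0 (d, i) ^+ 2)) mulr_sumr.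
  apply: eq_bigr => d _; rewrite /F0 /= sumr_const card_ord exprMn.
  by rewrite sqr_sqrtr ?(ltW mu_gt0) // sqr_energy_norm // -mulr_natr; ring.
have F1le : l2norm F1 <= Num.sqrt w.
  apply: ler_wsqrtr; rewrite -(pair_bigA _ (fun d i => F1 (d, i) ^+ 2)) exchange_big /=.
  have -> : \sum_i \sum_d F1 (d, i) ^+ 2 = \sum_(i < l0) sqstep (i + (s + tau)).
    apply: eq_bigr => i _; apply: (@mulfI _ n%:R); first by rewrite gt_eqF.
    rewrite (sqstep_residual (Ordinal (J'J i))) mulr_sumr; apply: eq_bigr => d _.
    rewrite /F1 exprMn exprVn sqr_sqrtr // sqr_l2norm mulrA mulfV ?mul1r // gt_eqF //.
  rewrite sum_ord_shift -/s' /w /sum_sqstep (@big_cat_nat _ _ _ (s + tau) s s') ?leq_addr //=.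
  by rewrite lerDr; exact: sum_sqstep_ge0.
have F2le : l2norm F2 <= omega rho tau * Num.sqrt w.
  rewrite omega_spread -[_ * spread]ger0_norm ?mulr_ge0 ?sqrtr_ge0 ?spread_ge0 //.
  rewrite -sqrtr_sqr -sqrtrM ?sqr_ge0 //; apply: ler_wsqrtr.
  rewrite -(pair_bigA _ (fun d i => F2 (d, i) ^+ 2)) exchange_big /=.
  have -> : (Num.sqrt tau%:R * spread) ^+ 2 * w = spread ^+ 2 * (tau%:R * w).
    by rewrite exprMn sqr_sqrtr //; ring.
  apply: le_trans (_ : spread ^+ 2 * \sum_(i < l0) unread_sqstep (i + (s + tau)) <= _).
    rewrite mulr_sumr; apply: ler_sum => i _; rewrite -(ler_pM2l nR_gt0) mulr_sumr mulrA.
    apply: le_trans (sumsq_unread_le (J'J i)); apply: ler_sum => d _.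
    by rewrite /F2 exprMn exprVn sqr_sqrtr // sqr_l2norm mulrA mulfV ?mul1r // gt_eqF.
  by rewrite sum_ord_shift ler_wpM2l ?sqr_ge0 // sum_unread_sqstep_le.
have F3le : l2norm F3 <= Num.sqrt (mu * l0%:R * (tau%:R + l0%:R - 1)) * Num.sqrt w.
  (* At most l0 <= tau + l0 - 1 steps lie between j and the end of the block. *)
  have t1 : 0 <= tau%:R - 1 :> R by rewrite subr_ge0 ler1n.
  have tl : 0 <= tau%:R + l0%:R - 1 :> R by rewrite addrAC addr_ge0.
  have ml : 0 <= mu * l0%:R by rewrite mulr_ge0 // ltW // mu_gt0.
  rewrite -sqrtrM; last exact: mulr_ge0.
  apply: ler_wsqrtr; rewrite -(pair_bigA _ (fun d i => F3 (d, i) ^+ 2)) exchange_big /=.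
  apply: (@le_trans _ _ (\sum_(i < l0) mu * l0%:R * w)); last first.
    rewrite sumr_const card_ord -[leLHS]mulr_natr [leRHS]mulrAC.
    by apply: ler_wpM2l; [exact: mulr_ge0|rewrite addrAC lerDr].
  apply: ler_sum => i _.
  apply: (@le_trans _ _ (\sum_d mu * l0%:R * \sum_(s <= k < s') g d k ^+ 2)).
    apply: ler_sum => d _; rewrite /F3 exprMn sqr_sqrtr ?(ltW mu_gt0) // -mulrA.
    rewrite ler_wpM2l ?(ltW mu_gt0) //=; apply: le_trans (sqr_sum_le _ _ _) _.
    have /andP[sj js'] := J's i.
    apply: ler_pM => //; first by apply: sumr_ge0 => k _; exact: sqr_ge0.
      by rewrite ler_nat count_predT size_iota /s' /J'; lia.
    rewrite [leRHS](@big_cat_nat _ _ _ (J' i)) ?(ltnW js') ?(leq_trans (leq_addr _ _) sj) //=.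
    under eq_bigr do rewrite real_normK ?num_real //.
    by rewrite lerDr; apply: sumr_ge0 => k _; exact: sqr_ge0.
  by rewrite -mulr_sumr exchange_big.
have : l2norm F0 <= (1 + beta * Num.sqrt (mu * l0%:R * (tau%:R + l0%:R - 1)) +
    beta * omega rho tau) * Num.sqrt w.
  apply: (@le_trans _ _ (l2norm (fun p => F1 p + (beta * F2 p + beta * F3 p)))).
    apply: l2norm_le => p; rewrite ger0_norm; last by rewrite mulr_ge0 ?sqrtr_ge0.
    exact: le_trans (pos p) (ler_norm _).
  apply: le_trans (l2normD _ _) _; rewrite -addrA mulrDl mul1r; apply: lerD => //.
  apply: le_trans (l2normD _ _) _; rewrite (l2normZ beta F2) (l2normZ beta F3) (gtr0_norm beta_gt0).
  by rewrite [leRHS]mulrDl [leRHS]addrC; apply: lerD; rewrite -mulrA ler_pM2l.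
move=> main; rewrite -[in leRHS](sqr_sqrtr w0) -exprMn.
have -> : mu * l0%:R * sqerr s' = l2norm F0 ^+ 2.
  by rewrite F0E sqr_sqrtr // mulr_ge0 ?sqerr_ge0 // mulr_ge0 // ltW // mu_gt0.
by rewrite lerXn2r ?nnegrE ?l2norm_ge0 // (le_trans (l2norm_ge0 F0)).
Qed.

(** [delayed_descent_rate] with h = beta^2 omega / tau, so that
    b - h tau = a; the denominator it requires is 1 + beta (2 - beta - beta
    omega) c, which is at most the one below. *)
Theorem averaged_contraction (l0 t : nat) :
  let om := omega rho tau in
  let c := c_const beta om mu tau l0 in
  0 < 2 - beta - 2 * beta * om -> (0 < l0)%N -> (t * (tau + l0) <= J)%N ->
  sqerr (t * (tau + l0)) <=
    (1 - a_const beta om * c / (1 + beta * (2 - beta - beta * om + beta * tau%:R) * c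
       + 2 * beta * Num.sqrt (tau%:R * c))) ^+ t * sqerr 0.
Proof.
move=> om c step_size l0_gt0 tJ.
have om_ge0 : 0 <= om by rewrite /om omega_spread mulr_ge0 ?sqrtr_ge0 ?spread_ge0.
have tau0 : 0 < tau%:R :> R by rewrite ltr0n.
have ml_gt0 : 0 < mu * l0%:R by rewrite mulr_gt0 ?mu_gt0 ?ltr0n.
pose K := 1 + beta * Num.sqrt (mu * l0%:R * (tau%:R + l0%:R - 1)) + beta * om.
have K_gt0 : 0 < K.
  by rewrite /K -addrA ltr_wpDr // addr_ge0 // mulr_ge0 ?sqrtr_ge0 ?(ltW beta_gt0).
have c_gt0 : 0 < c by rewrite divr_gt0 // exprn_gt0.
pose h := beta ^+ 2 * om / tau%:R.
have aE : a_const beta om = beta * (2 - beta - beta * om) - h * tau%:R.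
  by rewrite /a_const /h; field; rewrite gt_eqF.
rewrite aE; apply: (@delayed_descent_rate _ sqerr sqstep miss tau l0 J) => //.
- exact: sqerr_ge0.
- exact: sqstep_ge0.
- by rewrite /h mulr_ge0 ?invr_ge0 ?ler0n // mulr_ge0 ?sqr_ge0.
- by move=> j jJ; exact: sqerr_step.
- move=> s sJ; rewrite /c /c_const -/om -/K mulrAC ler_pdivrMr ?exprn_gt0 //.
  by rewrite [leRHS]mulrC; exact: recovery.
- by rewrite -aE mulr_gt0.
rewrite -subr_ge0 (_ : _ - _ =
  beta ^+ 2 * tau%:R * c + 2 * beta * Num.sqrt (tau%:R * c)); last by ring.
have b0 := ltW beta_gt0; have c0 := ltW c_gt0.
by apply: addr_ge0; (apply: mulr_ge0; last by rewrite ?sqrtr_ge0); apply: mulr_ge0; rewrite ?sqr_ge0 ?ler0n.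
Qed.

End AveragedDescent.

(** * Rescaling to unit diagonal *)

Section Rescaling.
Variables (R : realType) (n : nat) (A : 'M[R]_n).
Hypothesis A_pd : sym_posdef A.

Let scale i : R := Num.sqrt (A i i).
(** The matrix inverted in [rescaled]. *)
Definition sqrt_diag : 'M[R]_n := map_mx Num.sqrt (diag_part A).

Lemma posdef_diag_gt0 i : 0 < A i i.
Proof.
rewrite -(bform_deltas A); apply: A_pd.2; apply/eqP => /matrixP/(_ i 0).
by rewrite !mxE !eqxx => /eqP; rewrite oner_eq0.
Qed.

Let scale_gt0 i : 0 < scale i. Proof. by rewrite sqrtr_gt0 posdef_diag_gt0. Qed.
Let sqr_scale i : scale i ^+ 2 = A i i.
Proof. by rewrite sqr_sqrtr // ltW // posdef_diag_gt0. Qed.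

Lemma sqrt_diagE : sqrt_diag = diag_mx (\row_i scale i).
Proof. by apply/matrixP => i j; rewrite !mxE; case: eqP => // _; rewrite sqrtr0. Qed.

Lemma sqrt_diag_unit : sqrt_diag \in unitmx.
Proof.
rewrite sqrt_diagE unitmxE det_diag unitfE; apply/prodf_neq0 => i _.
by rewrite mxE gt_eqF.
Qed.

Lemma invmx_sqrt_diag : invmx sqrt_diag = diag_mx (\row_i (scale i)^-1).
Proof.
rewrite -[RHS](mulKmx sqrt_diag_unit) (_ : sqrt_diag *m diag_mx _ = 1%:M) ?mulmx1 //.
rewrite sqrt_diagE mul_diag_mx; apply/matrixP => i j; rewrite !mxE.
by case: eqP => [->|]; rewrite ?mulr1n ?mulfV ?mulr0 // gt_eqF.
Qed.

Lemma rescaledE : rescaled A = invmx sqrt_diag *m A *m invmx sqrt_diag.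
Proof. by []. Qed.

Lemma rescaled_entry i j : rescaled A i j = A i j / (scale i * scale j).
Proof.
rewrite rescaledE invmx_sqrt_diag mul_diag_mx mul_mx_diag !mxE invfM; ring.
Qed.

Lemma rescaled_diag i : rescaled A i i = 1.
Proof. by rewrite rescaled_entry -expr2 sqr_scale mulfV // gt_eqF // posdef_diag_gt0. Qed.

Lemma unscale : A = sqrt_diag *m rescaled A *m sqrt_diag.
Proof. by rewrite rescaledE mulmxA mulmxKV ?mulKVmx ?sqrt_diag_unit // mulmxA mulmxV ?mul1mx // sqrt_diag_unit. Qed.

Lemma sqrt_diag_tr : sqrt_diag^T = sqrt_diag.
Proof. by rewrite sqrt_diagE tr_diag_mx. Qed.

Lemma rescaled_posdef : sym_posdef (rescaled A).
Proof.
have invT : (invmx sqrt_diag)^T = invmx sqrt_diag by rewrite trmx_inv sqrt_diag_tr.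
split=> [|v v0]; first by rewrite rescaledE !trmx_mul invT A_pd.1 mulmxA.
have := A_pd.2 (invmx sqrt_diag *m v); rewrite trmx_mul invT.
rewrite rescaledE !mulmxA; apply.
by apply: contra_neq v0 => h; rewrite -(mulKVmx sqrt_diag_unit v) h mulmx0.
Qed.

Lemma rescaled_energy y : bform A y y = bform (rescaled A) (sqrt_diag *m y) (sqrt_diag *m y).
Proof. by rewrite {1}unscale /bform trmx_mul sqrt_diag_tr !mulmxA. Qed.

Lemma sqrt_diag_mul_delta (i : 'I_n) (a : R) :
  sqrt_diag *m (a *: delta_mx i 0 : 'cV[R]_n) = (scale i * a) *: delta_mx i 0.
Proof.
rewrite sqrt_diagE mul_diag_mx; apply/matrixP => r c; rewrite !mxE.
by case: eqP => [->|]; rewrite /= ?mulr0 // mulrA.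
Qed.

Lemma rescaled_row (y : 'cV[R]_n) i : (A *m y) i 0 = scale i * (rescaled A *m (sqrt_diag *m y)) i 0.
Proof.
by rewrite {1}unscale -!mulmxA {1}sqrt_diagE mul_diag_mx !mxE.
Qed.

End Rescaling.

Section OffPart.
Variables (R : realType) (n : nat) (m : memory_model n).

Lemma off_part_sym (M : 'M[R]_n) : M^T = M -> (off_part m M)^T = off_part m M.
Proof.
case: m => //= Q QP MT; apply/matrixP => r t; rewrite !mxE -{2}MT mxE.
have [r0 t0] : r \in [set: 'I_n]%SET /\ t \in [set: 'I_n]%SET by rewrite !inE.
have covQ : finset.cover Q = [set: 'I_n]%SET by case/and3P: QP => /eqP.
have trQ : finset.trivIset Q by case/and3P: QP.
suff -> : (r \in finset.pblock Q t) = (t \in finset.pblock Q r) by [].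
by rewrite -!eq_pblock ?covQ // eq_sym.
Qed.

Lemma off_part_entry (M : 'M[R]_n) r t : `|off_part m M r t| <= `|M r t|.
Proof. by case: m => //= Q QP; rewrite mxE; case: ifP => // _; rewrite normr0. Qed.

Lemma off_part_col_sum (A : 'M[R]_n) t :
  \sum_r `|off_part m (rescaled A) r t| <= n%:R * rho m A.
Proof.
have n0 : (0 < n)%N by case: t => t; case: (n).
rewrite /rho mulrA mulfV ?mul1r ?pnatr_eq0 -?lt0n //.
exact: (le_bigmax 0 (fun t => \sum_r `|off_part m (rescaled A) r t|)).
Qed.

Lemma rho_ge0 (A : 'M[R]_n) : 0 <= rho m A.
Proof.
rewrite /rho mulr_ge0 ?invr_ge0 //; elim/big_ind: _ => // [x y x0 y0|i _].
  by rewrite le_max x0.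
exact: sumr_ge0.
Qed.

End OffPart.

Lemma mulmx_scaled_delta (R : comPzRingType) (n : nat) (M : 'M[R]_n) a i j :
  (M *m (a *: delta_mx j (0 : 'I_1))) i 0 = a * M i j.
Proof. by rewrite -scalemxAr mxE -colE mxE. Qed.

(** * From the asynchronous iteration to the error recursion *)

Section ErrorTrajectory.
Variables (R : realType) (n : nat) (A : 'M[R]_n) (m : memory_model n).
Variables (xstar x0 : 'cV[R]_n) (beta : R) (dir : nat -> 'I_n).
Variables (Phit : forall j, {set 'I_j}) (gamma : nat -> R) (x : nat -> 'cV[R]_n).
Hypothesis A_pd : sym_posdef A.
Hypothesis iter : async_iteration A xstar x0 beta dir (read_set m dir Phit) gamma x.

Let s i : R := Num.sqrt (A i i).
Let g k := gamma k / s (dir k).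
Let S := sqrt_diag A.

Lemma scaled_update k : S *m update A beta dir gamma k = (beta * g k) *: delta_mx (dir k) 0.
Proof.
rewrite /update -/(bform _ _ _) bform_deltas mxE eqxx mulr1n mxE.
rewrite sqrt_diag_mul_delta; congr (_ *: _); rewrite /g /s.
have := posdef_diag_gt0 A_pd (dir k); move: (A _ _) => a a0.
have r0 : 0 < Num.sqrt a by rewrite sqrtr_gt0.
have aE := esym (sqr_sqrtr (ltW a0)).
by move: (Num.sqrt a) r0 aE => r r0 ->; field; rewrite gt_eqF.
Qed.

Lemma iterate_sum j : x j = x0 + \sum_(k < j) update A beta dir gamma k.
Proof.
have [x_0 step] := iter; elim: j => [|j IH]; first by rewrite big_ord0 addr0.
by rewrite big_ord_recr /= addrA -IH; have [_ ->] := step j.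
Qed.

(** A step on the updating node's own block is always read, which removes its
    entry of M; the off-diagonal part vanishes at that entry.  So the dependence
    of the read set on the current direction moves into the matrix. *)
Lemma off_part_unread j (k : 'I_j) (M : 'M[R]_n) :
  (if k \in read_set m dir Phit j then 0 else M (dir j) (dir k)) =
  (if k \in Phit j then 0 else off_part m M (dir j) (dir k)).
Proof.
case: m => //= Q QP; rewrite !inE mxE.
by case: (k \in Phit j) => //=; case: ifP.
Qed.

Lemma error_trajectory_of J (miss : nat -> nat -> bool) :
  (forall j (k : 'I_j), (j < J)%N -> miss j k = (k \notin Phit j)) ->
  error_trajectory (rescaled A) (off_part m (rescaled A)) beta J miss
    (S *m (xstar - x0)) dir (fun j => S *m (xstar - x j)) g.
Proof.
move=> missE; have [x_0 step] := iter; split; first by rewrite x_0.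
move=> j jJ; have [gj xj] := step j; split; last first.
  by rewrite xj opprD addrA mulmxBr scaled_update.
have s0 : s (dir j) != 0 by rewrite gt_eqF // sqrtr_gt0 posdef_diag_gt0.
have bf (y : 'cV[R]_n) : ((unit_dir R (dir j))^T *m A *m y) 0 0 = (A *m y) (dir j) 0 by exact: bform_delta.
rewrite /g gj bf rescaled_row // mulrAC mulfV // mul1r -/S.
set xr := x0 + _.
have -> : xstar - xr = (xstar - x j) +
    \sum_(k < j | k \notin read_set m dir Phit j) update A beta dir gamma k.
  rewrite iterate_sum (bigID (mem (read_set m dir Phit j))) /= /xr.
  by rewrite !opprD !addrA subrK.
rewrite mulmxDr mulmxDr /read_residual [LHS]mxE [RHS]mxE; congr (_ + _).
rewrite [RHS]mxE !mulmx_sumr !summxE mulr_sumr (big_mkord (fun k => miss j k)).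
rewrite big_mkcond [RHS]big_mkcond; apply: eq_bigr => k _ /=.
rewrite scaled_update !mulmx_scaled_delta.
have := off_part_unread k (rescaled A); rewrite (missE j k jJ).
case: (k \in read_set _ _ _ _); case: (k \in Phit j) => //=.
  by move=> <-; rewrite mulr0 mulr0.
by move=> ->; rewrite mulr0.
by move=> ->; rewrite -mulrA.
Qed.

End ErrorTrajectory.

(** * Reduction to a fixed schedule *)

Section FirstSteps.
Variables (T : Type) (n J : nat) (dir : nat -> T -> 'I_n).
Variable Phit : forall j, T -> {set 'I_j}.

Definition directions (w : T) : {ffun 'I_J -> 'I_n} := [ffun j : 'I_J => dir j w].
(** A dependent finite function, so that initial segments of the schedule form
    a finite type. *)
Definition schedule (w : T) : {dffun forall j : 'I_J, {set 'I_j}} :=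
  [ffun j : 'I_J => Phit j w].

Definition missing (phi : {dffun forall j : 'I_J, {set 'I_j}}) (j k : nat) : bool :=
  if (insub j : option 'I_J) is Some jj then
    if (insub k : option 'I_jj) is Some kk then kk \notin phi jj else false
  else false.

Lemma missing_schedule w j (k : 'I_j) : (j < J)%N ->
  missing (schedule w) j k = (k \notin Phit j w).
Proof.
move=> jJ; rewrite /missing (insubT (fun i => i < J)%N jJ) /=.
by rewrite (valK k) ffunE.
Qed.

Lemma missing_recent tau w j k :
  bounded_delay tau (Phit ^~ w) -> missing (schedule w) j k -> (j < k + tau)%N.
Proof.
move=> delay; rewrite /missing; case: insubP => // -[j' j'J] /= _ <-.
case: insubP => // kk _ <-; rewrite ffunE => kP; rewrite ltnNge.
by apply: contra kP; exact: delay.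
Qed.

End FirstSteps.

Section FiniteLaws.
Context (d : measure_display) (T : measurableType d) (R : realType).
Variable P : probability T R.
Local Open Scope classical_set_scope.
Local Open Scope ereal_scope.

Lemma expectation_finite_rv (V : finType) (Z : T -> V) (h : V -> R) :
  finite_rv Z -> (forall v, (0 <= h v)%R) ->
  'E_P[h \o Z] = \sum_v (h v)%:E * P (Z @^-1` [set v]).
Proof.
move=> mZ h0; rewrite unlock.
have -> : (fun w => (((h \o Z) w)%:E)) =
    (fun w => \sum_v (h v * \1_(Z @^-1` [set v]) w)%:E).
  apply/funext => w; rewrite (bigD1 (Z w)) //= big1 => [|v vZ].
    by rewrite indicE mem_set ?mulr1 ?adde0.
  by rewrite indicE memNset ?mulr0 // => /= /esym; exact/eqP.
rewrite ge0_integral_sum //; last 2 first.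
- move=> v; apply/measurable_EFinP; apply: measurable_funM => //.
- by move=> v w _; rewrite lee_fin mulr_ge0.
apply: eq_bigr => v _.
rewrite (integralZl_indic _ (fun _ => Z @^-1` [set v])) //; last by move=> /lt_geF; rewrite h0.
by rewrite integral_indic // setIT.
Qed.

(** An event on finitely many terms of a sequence belongs to the sigma-algebra
    that the sequence generates; this makes [independent_sequences] applicable
    to initial segments. *)
Lemma sigma_gen_bigcap (V : nat -> finType) (X : forall j, T -> V j)
    (J : nat) (B : forall j, set (V j)) :
  sigma_gen X (\bigcap_(j in [set` iota 0 J]) X j @^-1` B j).
Proof.
rewrite /sigma_gen; set G := [set E | _].
apply: (@fin_bigcap_measurable _ (g_sigma_algebraType G)).
  exact: finite_seq.
move=> j _; apply: sub_sigma_algebra; by exists j, (B j).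
Qed.

Section DirectionsAndSchedule.
Variables (n J : nat) (dir : nat -> T -> 'I_n) (Phit : forall j, T -> {set 'I_j}).
Hypothesis dir_rv : forall j, finite_rv (dir j).
Hypothesis Phit_rv : forall j, finite_rv (Phit j).
Hypothesis dir_iid : iid_uniform P dir.
Hypothesis indep : independent_sequences P dir Phit.

Local Notation directions := (directions J dir).
Local Notation schedule := (schedule J Phit).

(* These sets of values are defined for every j, although d0 and phi are only
   defined below J, so that they can index an intersection over nat. *)
Let direction_event (d0 : {ffun 'I_J -> 'I_n}) j : set 'I_n :=
  [set i | forall jJ : (j < J)%N, i = d0 (Ordinal jJ)].
Let read_event (phi : {dffun forall j : 'I_J, {set 'I_j}}) j : set {set 'I_j} :=
  [set Q : {set 'I_j} | forall jJ : (j < J)%N, Q = phi (Ordinal jJ) :> {set 'I_j}].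
Arguments read_event : clear implicits.

Lemma directions_preimage d0 : directions @^-1` [set d0] =
  \bigcap_(j in [set` iota 0 J]) dir j @^-1` direction_event d0 j.
Proof.
apply/seteqP; split=> w /=.
  by move=> <- j _ jJ /=; rewrite ffunE.
move=> h; apply/ffunP => j; rewrite ffunE.
have := h j; rewrite /= mem_iota /= add0n => /(_ (ltn_ord j)) /(_ (ltn_ord j)) ->.
by congr (d0 _); exact: val_inj.
Qed.

Lemma schedule_preimage phi : schedule @^-1` [set phi] =
  \bigcap_(j in [set` iota 0 J]) Phit j @^-1` read_event phi j.
Proof.
apply/seteqP; split=> w /=.
  by move=> <- j _ jJ /=; rewrite ffunE.
move=> h; apply/ffunP => -[j jJ]; rewrite ffunE.
by have := h j; rewrite /= mem_iota /= add0n => /(_ jJ) /(_ jJ).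
Qed.

Let direction_eventE d0 j (jJ : (j < J)%N) :
  direction_event d0 j = [set d0 (Ordinal jJ)].
Proof.
apply/seteqP; split=> i /=; first exact.
by move=> -> jJ'; congr (d0 _); exact: val_inj.
Qed.

Let read_eventE phi j (jJ : (j < J)%N) : read_event phi j = [set phi (Ordinal jJ)].
Proof.
apply/seteqP; split=> i /=; first exact.
by move=> -> jJ'; rewrite (bool_irrelevance jJ jJ').
Qed.

Lemma finite_rv_directions : finite_rv directions.
Proof.
move=> d0; rewrite directions_preimage; apply: fin_bigcap_measurable; first exact: finite_seq.
by move=> j; rewrite /= mem_iota /= add0n => jJ; rewrite direction_eventE; exact: dir_rv.
Qed.

Lemma finite_rv_schedule : finite_rv schedule.
Proof.
move=> phi; rewrite schedule_preimage; apply: fin_bigcap_measurable; first exact: finite_seq.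
by move=> j; rewrite /= mem_iota /= add0n => jJ; rewrite read_eventE; exact: Phit_rv.
Qed.

Lemma directions_law d0 : P (directions @^-1` [set d0]) = ((n%:R^-1) ^+ J)%:E.
Proof.
rewrite directions_preimage (dir_iid.2 (iota 0 J) (direction_event d0)) ?iota_uniq //.
rewrite (eq_big_seq (fun=> (n%:R^-1)%:E)); last first.
  by move=> j; rewrite mem_iota /= add0n => jJ; rewrite direction_eventE dir_iid.1.
by rewrite big_const_seq count_predT size_iota; elim: J => //= k ->; rewrite exprS EFinM.
Qed.

Lemma joint_preimage d0 phi : (fun w => (directions w, schedule w)) @^-1` [set (d0, phi)] =
  directions @^-1` [set d0] `&` schedule @^-1` [set phi].
Proof. by apply/seteqP; split=> w /= [-> ->]. Qed.

Lemma joint_law d0 phi :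
  P ((fun w => (directions w, schedule w)) @^-1` [set (d0, phi)]) =
  ((n%:R^-1) ^+ J)%:E * P (schedule @^-1` [set phi]).
Proof.
rewrite joint_preimage indep ?directions_law //.
  by rewrite directions_preimage; exact: sigma_gen_bigcap.
by rewrite schedule_preimage; exact: sigma_gen_bigcap.
Qed.

(** Conditioning on the schedule: given it, the first J directions are uniform,
    so a bound on the average over directions that is uniform over the
    reachable schedules bounds the expectation. *)
Lemma expectation_uniform_le (h : {ffun 'I_J -> 'I_n} -> {dffun forall j : 'I_J, {set 'I_j}} -> R)
    (K : R) :
  (forall d0 phi, (0 <= h d0 phi)%R) -> (0 < n)%N ->
  (forall phi, P (schedule @^-1` [set phi]) != 0 -> (\sum_d0 h d0 phi <= n%:R ^+ J * K)%R) ->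
  'E_P[fun w => h (directions w) (schedule w)] <= K%:E.
Proof.
move=> h0 n0 hK.
have mZ : finite_rv (fun w => (directions w, schedule w)).
  move=> [d0 phi]; rewrite joint_preimage; apply: measurableI.
    exact: finite_rv_directions.
  exact: finite_rv_schedule.
have -> : (fun w => h (directions w) (schedule w)) =
  (fun p => h p.1 p.2) \o (fun w => (directions w, schedule w)) by [].
rewrite expectation_finite_rv //.
rewrite (eq_bigr (fun p => (h p.1 p.2)%:E * (((n%:R^-1) ^+ J)%:E * P (schedule @^-1` [set p.2])))); last first.
  by move=> [d0 phi] _; rewrite joint_law.
rewrite -(pair_bigA _ (fun d0 phi => (h d0 phi)%:E *
  (((n%:R^-1) ^+ J)%:E * P (schedule @^-1` [set phi])))) exchange_big /=.
have -> : K%:E = \sum_phi K%:E * P (schedule @^-1` [set phi]).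
  rewrite -ge0_sume_distrr //.
  have := expectation_finite_rv (h := fun=> 1%R) finite_rv_schedule (fun=> ler01).
  by under eq_bigr do rewrite mul1e; rewrite expectation_cst => <-; rewrite mule1.
apply: lee_sum => phi _.
have fp := fin_num_measure P _ (finite_rv_schedule phi).
have [->|p0] := eqVneq (P (schedule @^-1` [set phi])) 0.
  by rewrite !mule0 big1 // => d0 _; rewrite !mule0.
have := hK phi p0; rewrite -(fineK fp).
have : (0 <= fine (P (schedule @^-1` [set phi])))%R by rewrite fine_ge0.
move: (fine _) => p p_ge0 hphi.
under eq_bigr do rewrite -!EFinM.
rewrite sumEFin -EFinM lee_fin -mulr_suml mulrA ler_wpM2r //.
by rewrite exprVn ler_pdivrMr ?exprn_gt0 ?ltr0n // mulrC.
Qed.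

End DirectionsAndSchedule.

End FiniteLaws.

Unset Implicit Arguments.
Local Open Scope classical_set_scope.
Local Open Scope ring_scope.

Theorem theorem1 (R : realType) (dT : measure_display) (T : measurableType dT)
    (P : probability T R) (n : nat) (A : 'M[R]_n) (b xstar x0 : 'cV[R]_n)
    (m : memory_model n) (tau : nat) (beta : R)
    (dir : nat -> T -> 'I_n) (Phit : forall j : nat, T -> {set 'I_j})
    (gamma : nat -> T -> R) (x : nat -> T -> 'cV[R]_n) :
  sym_posdef A ->
  A *m xstar = b ->
  (1 <= tau)%N ->
  0 < beta < 2 ->
  (forall j : nat, finite_rv (dir j)) ->
  (forall j : nat, finite_rv (Phit j)) ->
  iid_uniform P dir ->
  independent_sequences P dir Phit ->
  (forall w : T, bounded_delay tau (Phit ^~ w)) ->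
  (forall w : T, async_iteration A xstar x0 beta (dir ^~ w)
     (read_set m (dir ^~ w) (Phit ^~ w)) (gamma ^~ w) (x ^~ w)) ->
  let om := omega (rho m A) tau in
  let a := a_const beta om in
  let mu := lambda_min (rescaled A) / n%:R in
  let err (j : nat) := ('E_P[fun w : T => (energy_norm A (x j w - xstar) ^+ 2)%R])%E in
  0 < 2 - beta - 2 * beta * om ->
  0 < a /\
  forall l0 : nat, (1 <= l0)%N ->
    let c := c_const beta om mu tau l0 in
    forall t : nat,
    (err (t * (tau + l0))%N <=
     ((1 - a * c / (1 + beta * (2 - beta - beta * om + beta * tau%:R) * c
                    + 2 * beta * Num.sqrt (tau%:R * c))) ^+ t)%:E * err 0%N)%E.
Proof.
move=> A_pd _ tau_gt0 /andP[beta_gt0 _] dir_rv Phit_rv dir_iid indep delay iter om a mu err step_size.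
split=> [|l0 l0_gt0 c t]; first exact: mulr_gt0.
set rate := 1 - _; set J := (t * (tau + l0))%N.
have [w0 _] : [set: T] !=set0.
  apply/set0P/eqP => T0; have := probability_setT P; rewrite T0 measure0 => /eqP.
  by rewrite eqe eq_sym oner_eq0.
have n_gt0 : (0 < n)%N by apply: leq_ltn_trans (ltn_ord (dir 0%N w0)).
pose B := rescaled A; pose C := off_part m B.
pose e w j := sqrt_diag A *m (xstar - x j w).
pose e0 := sqrt_diag A *m (xstar - x0).
have B_pd : sym_posdef B := rescaled_posdef A_pd.
have B_psd := posdef_psd B_pd.
have errE j : err j = ('E_P[fun w => bform B (e w j) (e w j)])%E.
  congr expectation; apply/funext => w.
  rewrite sqr_energy_norm; last exact: posdef_psd.
  by rewrite -opprB -scaleN1r bformZl bformZr !mulN1r opprK rescaled_energy.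
pose Z w := (directions J dir w, schedule J Phit w).
(* The error after J steps depends on the sample point only through Z, so it is
   a function of Z: evaluate it at a chosen preimage. *)
pose rep v := if pselect (exists w, Z w = v) is left ex then projT1 (cid ex) else w0.
have repK v : (exists w, Z w = v) -> Z (rep v) = v.
  by move=> ex; rewrite /rep; case: pselect => // ex'; exact: projT2 (cid ex').
have traj w := error_trajectory_of A_pd (iter w)
  (fun j k => @missing_schedule T J Phit w j k).
pose h d0 phi := bform B (e (rep (d0, phi)) J) (e (rep (d0, phi)) J).
have errJ : err J = ('E_P[fun w => h (directions J dir w) (schedule J Phit w)])%E.
  rewrite errE; congr expectation; apply/funext => w; rewrite /h -/(Z w).
  have Zw : Z (rep (Z w)) = Z w by apply: repK; exists w.
  have [dE sE] : directions J dir (rep (Z w)) = directions J dir w /\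
    schedule J Phit (rep (Z w)) = schedule J Phit w by case: Zw.
  have := traj (rep (Z w)); rewrite sE => traj'.
  suff [-> _] : e (rep (Z w)) J = e w J /\ True by [].
  split=> //; apply: (trajectory_causal traj' (traj w) (leqnn J) _).1 => k kJ.
  by have := congr1 (fun f : {ffun 'I_J -> 'I_n} => f (Ordinal kJ)) dE; rewrite !ffunE.
have err0 : err 0%N = (bform B e0 e0)%:E.
  rewrite errE -(expectation_cst P); congr expectation; apply/funext => w.
  by rewrite /e (iter w).1.
rewrite errJ err0 -EFinM; apply: (expectation_uniform_le dir_rv Phit_rv dir_iid indep) => //.
  by move=> d0 phi; exact: B_psd.2.
move=> phi phi_gt0.
(* By independence every direction sequence occurs together with phi. *)
have reached d0 : Z (rep (d0, phi)) = (d0, phi).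
  apply: repK; apply/not_existsP => none.
  have := joint_law dir_iid indep d0 phi.
  rewrite (_ : _ @^-1` _ = set0); last by apply/seteqP; split=> // w /= /none.
  rewrite measure0 => /esym/eqP; rewrite mule_eq0 (negbTE phi_gt0) orbF eqe.
  by rewrite expf_eq0 invr_eq0 pnatr_eq0 (gtn_eqF n_gt0) andbF.
have rep_dir d0 (k : 'I_J) : dir k (rep (d0, phi)) = d0 k.
  by have [/ffunP/(_ k)] := reached d0; rewrite ffunE.
have rep_sched d0 : schedule J Phit (rep (d0, phi)) = phi.
  by have /(congr1 snd) := reached d0.
have rep_traj d0 := traj (rep (d0, phi)).
have rep_traj' d0 : error_trajectory B C beta J (missing phi) e0
    (dir ^~ (rep (d0, phi))) (e (rep (d0, phi)))
    (fun k => gamma k (rep (d0, phi)) / Num.sqrt (A (dir k (rep (d0, phi))) (dir k (rep (d0, phi))))).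
  by have := rep_traj d0; rewrite rep_sched.
have missW j k : missing phi j k -> (j < k + tau)%N.
  rewrite -(rep_sched [ffun=> dir 0%N w0]); exact: missing_recent.
have := averaged_contraction (fun d0 k => rep_dir d0 k) rep_traj' n_gt0 B_pd
  (rescaled_diag A_pd) (off_part_sym m B_pd.1)
  (fun r s => le_trans (off_part_entry m B r s) (psd_entry_le1 r s B_psd (rescaled_diag A_pd)))
  (off_part_col_sum m A) (rho_ge0 m A) beta_gt0 tau_gt0 missW step_size l0_gt0 (leqnn J).
rewrite /sqerr -/om -/a -/mu -/c -/rate -/J => /le_trans; apply.
rewrite (eq_bigr (fun=> bform B e0 e0)); last by move=> d0 _; have [-> _] := rep_traj' d0.
by rewrite sumr_const card_ffun !card_ord mulrnAr -[leLHS]mulr_natl natrX.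
Qed.
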